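(* Consider the Riemannian product $M^n\times\mathbb{R}^k$ with horizontal weight $e^{\psi(p,t)}:=e^{h(p)}$, where $h\in C^\infty(M)$. If $\Sigma$ is a two-sided, compact and connected $\psi$-minimal hypersurface in $M\times\mathbb{R}^k$ with $\partial\Sigma\neq\emptyset$, then $\Sigma$ is contained in the horizontal convex hull of $\partial\Sigma$. Moreover, if $\partial\Sigma\subset M\times P$ for some (affine) hyperplane $P\subset\mathbb{R}^k$, then $\Sigma\subset M\times P$.
   Context: $M^n$ is a connected oriented $n$-dimensional Riemannian manifold, possibly with smooth boundary; $M\times\mathbb{R}^k$ ($k\geq 1$) is the Riemannian product with Euclidean space. For a two-sided smooth hypersurface $\Sigma$ (possibly with smooth boundary $\partial\Sigma$) with unit normal $N$, the $\psi$-mean curvature is $H_\psi:=-\operatorname{div}_\Sigma N-\langle\nabla\psi,N\rangle$, and $\Sigma$ is $\psi$-minimal if $H_\psi=0$ on $\Sigma$. A horizontal half-space in $M\times\mathbb{R}^k$ is a set of the form $M\times F$, where $F$ is a closed half-space in $\mathbb{R}^k$. The horizontal convex hull of a non-empty compact set $S\subset M\times\mathbb{R}^k$ is the intersection of all the horizontal half-spaces containing $S$. *)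

(* Defs.v *)
From HB Require Import structures.
From mathcomp Require Import all_boot all_order all_algebra.
From mathcomp Require Import all_classical all_reals all_analysis.
Set Implicit Arguments.
Unset Strict Implicit.
Unset Printing Implicit Defensive.
Import Order.TTheory GRing.Theory Num.Theory.
Import numFieldNormedType.Exports.
Local Open Scope classical_set_scope.
Local Open Scope ring_scope.

(* Vectors are rows: the Jacobian of F has the partial derivative along the    *)
(* i-th coordinate as its i-th row, and acts on tangent vectors on the right.  *)

Section Calculus.
Variables (R : realType) (n : nat).
Implicit Types (A O : set 'rV[R]_n) (f : 'rV[R]_n -> R) (x : 'rV[R]_n).

Definition basis_vec (i : 'I_n) : 'rV[R]_n := delta_mx 0 i.

Fixpoint Cr (r : nat) O f : Prop :=
  (forall x, O x -> {for x, continuous f}) /\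
  (if r is r'.+1 then
     forall i : 'I_n, (forall x, O x -> derivable f x (basis_vec i)) /\
                      Cr r' O (fun x => 'D_(basis_vec i) f x)
   else True).

(* A function on an arbitrary subset is smooth when it extends, near each      *)
(* point, to a smooth function on an open subset of R^n.                       *)
Definition smooth_on A f : Prop :=
  forall x, A x -> exists (O : set 'rV[R]_n) (F : 'rV[R]_n -> R),
    [/\ open O, O x, (forall r, Cr r O F)
      & forall y, A y -> O y -> F y = f y].

Definition smooth_on_vec d A (F : 'rV[R]_n -> 'rV[R]_d) : Prop :=
  forall j, smooth_on A (fun x => F x 0 j).

(* i-th partial derivative at x, the increments being restricted to those that *)
(* stay in A; on the boundary of a half-space the one transverse to the        *)
(* boundary is one-sided.                                                      *)
Definition partial A f x (i : 'I_n) : R :=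
  lim ((fun t : R => t^-1 * (f (x + t *: basis_vec i) - f x)) @
       within [set t : R | A (x + t *: basis_vec i)] 0^').

Definition jac d A (F : 'rV[R]_n -> 'rV[R]_d) x : 'M[R]_(n, d) :=
  \matrix_(i, j) partial A (fun y => F y 0 j) x i.

(* Empty for n = 0. *)
Definition half_space : set 'rV[R]_n :=
  [set x | exists i : 'I_n, val i = 0%N /\ 0 <= x 0 i].

End Calculus.

Section Manifolds.
Variable R : realType.

(* An atlas need not be maximal. A chart with bdry = false is modelled on R^n, *)
(* one with bdry = true on the closed half-space; chart_inv is the inverse of  *)
(* chart_map on dom, and is irrelevant outside the image of dom.               *)
Record atlas (T : topologicalType) (n : nat) := Atlas {
  chart : Type;
  dom : chart -> set T;
  chart_map : chart -> T -> 'rV[R]_n;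
  chart_inv : chart -> 'rV[R]_n -> T;
  bdry : chart -> bool }.

Section Atlas.
Variables (T : topologicalType) (n : nat) (A : atlas T n).
Implicit Types (c : chart A) (p : T).

Definition chart_image c : set 'rV[R]_n := chart_map c @` dom c.

Definition model c : set 'rV[R]_n :=
  if bdry c then @half_space R n else setT.

Definition transition c c' : 'rV[R]_n -> 'rV[R]_n :=
  chart_map c' \o chart_inv c.

Definition overlap c c' : set 'rV[R]_n := chart_map c @` (dom c `&` dom c').

Definition smooth_manifold : Prop :=
  [/\ hausdorff_space T,
      @second_countable T,
      (forall p, exists c, dom c p),
      (forall c,
        [/\ open (dom c),
            (forall p, dom c p -> chart_inv c (chart_map c p) = p),
            (exists2 O, open O & chart_image c = O `&` model c),
            {within dom c, continuous (chart_map c)}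
          & {within chart_image c, continuous (chart_inv c)}])
    & forall c c', smooth_on_vec (overlap c c') (transition c c')].

Definition boundary : set T :=
  [set p | exists c, [/\ dom c p, bdry c
    & exists i : 'I_n, val i = 0%N /\ chart_map c p 0 i = 0]].

(* o c p tells whether the coordinate frame of c at p is positively oriented.  *)
(* Recording this, rather than requiring oriented charts, is needed in         *)
(* dimension 1, where a segment has no oriented atlas modelled on [0, +oo).    *)
Definition orientation (o : chart A -> T -> bool) : Prop :=
  (forall c p, dom c p -> \forall q \near p, o c q = o c p) /\
  (forall c c' p, dom c p -> dom c' p ->
     (o c p == o c' p) =
     (0 < \det (jac (overlap c c') (transition c c') (chart_map c p)))).

Definition smooth_fun (h : T -> R) : Prop :=
  forall c, smooth_on (chart_image c) (h \o chart_inv c).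

(* A metric is given by its Gram matrix in each chart. *)
Definition metric := chart A -> 'rV[R]_n -> 'M[R]_n.

Definition inner (G : 'M[R]_n) (u v : 'rV[R]_n) : R := (u *m G *m v^T) 0 0.

Definition riemannian (g : metric) : Prop :=
  [/\ (forall c i j, smooth_on (chart_image c) (fun x => g c x i j)),
      (forall c x, chart_image c x -> (g c x)^T = g c x),
      (forall c x v, chart_image c x -> v != 0 -> 0 < inner (g c x) v v)
    & forall c c' x, overlap c c' x ->
        let J := jac (overlap c c') (transition c c') x in
        g c x = J *m g c' (transition c c' x) *m J^T].

(* Christoffel symbol $\Gamma^l_{ab}$ of the Levi-Civita connection. *)
Definition christoffel (g : metric) c (x : 'rV[R]_n) (l a b : 'I_n) : R :=
  let dg r i j := partial (chart_image c) (fun y => g c y i j) x r in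
  2^-1 * \sum_r invmx (g c x) l r * (dg a b r + dg b a r - dg r a b).

Definition gradient (g : metric) (f : T -> R) c (x : 'rV[R]_n) : 'rV[R]_n :=
  (\row_a partial (chart_image c) (f \o chart_inv c) x a) *m invmx (g c x).

End Atlas.

Section Hypersurface.
Variables (S W : topologicalType) (m d : nat).
Variables (B : atlas S m) (A : atlas W d) (g : metric A) (iota : S -> W).
Implicit Types (s : chart B) (c : chart A) (q : S).

Definition local_dom s c : set 'rV[R]_m :=
  chart_map s @` (dom s `&` iota @^-1` dom c).

Definition local_map s c : 'rV[R]_m -> 'rV[R]_d :=
  chart_map c \o iota \o chart_inv s.

(* The rows are the components in c of the coordinate vector fields of s. *)
Definition tangent s c q : 'M[R]_(m, d) :=
  jac (local_dom s c) (local_map s c) (chart_map s q).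

Definition metric_at c q : 'M[R]_d := g c (chart_map c (iota q)).

(* iota need not be injective, so embedded hypersurfaces are a special case.   *)
Definition immersed_hypersurface : Prop :=
  [/\ m.+1 = d, smooth_manifold B, continuous iota,
      (forall s c, smooth_on_vec (local_dom s c) (local_map s c))
    & forall s c q, dom s q -> dom c (iota q) -> row_free (tangent s c q)].

(* N c q is the row of components, in the chart c, of a vector tangent to W at *)
(* iota q.                                                                     *)
Definition unit_normal (N : chart A -> S -> 'rV[R]_d) : Prop :=
  [/\ (forall c c' q, dom c (iota q) -> dom c' (iota q) ->
         N c' q =
         N c q *m jac (overlap c c') (transition c c') (chart_map c (iota q))),
      (forall s c, smooth_on_vec (local_dom s c) (N c \o chart_inv s)),
      (forall c q, dom c (iota q) -> inner (metric_at c q) (N c q) (N c q) = 1)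
    & forall s c q, dom s q -> dom c (iota q) ->
        forall i, inner (metric_at c q) (row i (tangent s c q)) (N c q) = 0].

Variable N : chart A -> S -> 'rV[R]_d.

(* Row i: the Levi-Civita derivative of N along the i-th coordinate field. *)
Definition cov_deriv s c q : 'M[R]_(m, d) :=
  \matrix_(i, l)
    (jac (local_dom s c) (N c \o chart_inv s) (chart_map s q) i l +
     \sum_a \sum_b christoffel g c (chart_map c (iota q)) l a b *
                   tangent s c q i a * N c q 0 b).

Definition induced_metric s c q : 'M[R]_m :=
  tangent s c q *m metric_at c q *m (tangent s c q)^T.

(* Trace over the tangent space of X, Y |-> <D_X N, Y>, with respect to the    *)
(* induced metric.                                                             *)
Definition div_hyp s c q : R :=
  \tr (invmx (induced_metric s c q) *m
       (cov_deriv s c q *m metric_at c q *m (tangent s c q)^T)).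

Definition weighted_mean_curvature (psi : W -> R) s c q : R :=
  - div_hyp s c q
  - inner (metric_at c q) (gradient g psi c (chart_map c (iota q))) (N c q).

Definition weighted_minimal (psi : W -> R) : Prop :=
  forall s c q, dom s q -> dom c (iota q) ->
    weighted_mean_curvature psi s c q = 0.

End Hypersurface.

Section Product.
Variables (T : topologicalType) (n k : nat) (A : atlas T n).

Definition prod_atlas : atlas (T * 'rV[R]_k)%type (n + k) :=
  @Atlas (T * 'rV[R]_k)%type (n + k) (chart A)
    (fun c => dom c `*` setT)
    (fun c z => row_mx (chart_map c z.1) z.2)
    (fun c x => (chart_inv c (lsubmx x), rsubmx x))
    (@bdry T n A).

Definition prod_metric (g : metric A) : metric prod_atlas :=
  fun c x => block_mx (g c (lsubmx x)) 0 0 1%:M.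

End Product.

Section HorizontalHull.
Variables (T : Type) (k : nat).

Definition closed_half_space (F : set 'rV[R]_k) : Prop :=
  exists (a : 'rV[R]_k) (b : R),
    a != 0 /\ F = [set t | (a *m t^T) 0 0 <= b].

Definition affine_hyperplane (P : set 'rV[R]_k) : Prop :=
  exists (a : 'rV[R]_k) (b : R),
    a != 0 /\ P = [set t | (a *m t^T) 0 0 = b].

Definition horizontal_half_space (H : set (T * 'rV[R]_k)) : Prop :=
  exists2 F, closed_half_space F & H = setT `*` F.

Definition horizontal_hull (X : set (T * 'rV[R]_k)) : set (T * 'rV[R]_k) :=
  \bigcap_(H in [set H | horizontal_half_space H /\ X `<=` H]) H.

End HorizontalHull.
End Manifolds.
Arguments prod_metric {R T n} k {A} g.

(* Main.v *)
Require Import Defs.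
From HB Require Import structures.
From mathcomp Require Import all_boot all_order all_algebra.
From mathcomp Require Import all_classical all_reals all_analysis.
From mathcomp Require Import lra ring.
Set Implicit Arguments.
Unset Strict Implicit.
Unset Printing Implicit Defensive.
Import Order.TTheory GRing.Theory Num.Theory.
Import numFieldNormedType.Exports.
Local Open Scope classical_set_scope.
Local Open Scope ring_scope.

(* The coordinate functions of the Euclidean factor are linear, the weight does  *)
(* not depend on them, and both facts make every height q |-> <al, t(q)> of a    *)
(* psi-minimal hypersurface a solution of a linear elliptic equation without     *)
(* zero order term.  In charts, if T is the matrix of coordinate vectors and G   *)
(* the Gram matrix along the immersion F, H_psi = 0 says that the covector       *)
(*   V_b = a^{ij} <D_i d_j F, e_b> - d_b psi,   a = (T G T^t)^-1,                *)
(* annihilates N, so it is a combination beta T G of the tangent covectors; its  *)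
(* Euclidean components read a^{ij} d_i d_j F^l = beta^q d_q F^l.  By Hopf's     *)
(* strong maximum principle the set where a height                               *)
(* attains its maximum over the compact S is open away from the boundary, so by  *)
(* connectedness it meets the boundary.  Applied to the normals of half-spaces   *)
(* this is the first claim, and applied to both normals of P the second one.     *)

(** Geometrically, a linear height on a psi-minimal hypersurface is harmonic for the drifted
    Laplacian Delta + <grad psi, grad .> of the induced metric: the height has zero Hessian in the
    product, and psi is constant in the Euclidean directions. [lowered_trace_tangent] obtains the
    nondivergence form of this equation by linear algebra at one point, from H_psi = 0 and the
    derivative of <d_j F, N> = 0; [vertical_equation] reads off its Euclidean components.

    The coefficients are continuous and the second order part is positive definite, so
    [strong_max_principle] applies in charts off the boundary ([strong_max_height],
    [height_locally_cst]), and [height_max_boundary] globalises by connectedness. The analytic core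
    is [no_interior_touch], a comparison with an explicit barrier, which rests on the trace
    inequality [psd_trace_le0].

    Interior points of the hypersurface may lie over boundary points of M, where derivatives of the
    metric are one-sided; [partial_extension] identifies them with those of any smooth extension. *)

Lemma cvg_sumr (R : realType) (T I : Type) (F : set_system T) {FF : Filter F}
    (r : seq I) (P : pred I) (f : I -> T -> R) (a : I -> R) :
  (forall i, P i -> f i x @[x --> F] --> a i) ->
  \sum_(i <- r | P i) f i x @[x --> F] --> \sum_(i <- r | P i) a i.
Proof. by move=> fa; apply: cvg_big => //; exact: add_continuous. Qed.

(** * Differential calculus in coordinates *)

Lemma mean_value_centered (R : realType) (phi dphi : R -> R) (s : R) :
  (forall t : R, `|t| <= `|s| -> is_derive t (1 : R) phi (dphi t)) ->
  exists2 c, `|c| <= `|s| & phi s - phi 0 = dphi c * s.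
Proof.
move=> dphiP.
have cont t : `|t| <= `|s| -> {for t, continuous phi}.
  move=> /dphiP d; apply/differentiable_continuous/derivable1_diffP.
  exact: ex_derive.
have [s0|s0] := leP 0 s.
  have itvP t : t \in `[0, s] -> `|t| <= `|s|.
    by rewrite in_itv/= => /andP[t0 ts]; rewrite !ger0_norm.
  have [||c /itvP cs /[!subr0]] := @MVT_segment R phi dphi 0 s s0; last by exists c.
    by move=> t /subset_itv_oo_cc /itvP /dphiP.
  by apply: continuous_in_subspaceT => t /[!inE] /itvP /cont.
have itvP t : t \in `[s, 0] -> `|t| <= `|s|.
  by rewrite in_itv/= => /andP[t0 ts]; rewrite !ler0_norm ?lerN2// ltW.
have [||c /itvP cs] := @MVT_segment R phi dphi s 0 (ltW s0).
  - by move=> t /subset_itv_oo_cc /itvP /dphiP.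
  - by apply: continuous_in_subspaceT => t /[!inE] /itvP /cont.
by rewrite sub0r mulrN => /eqP; rewrite -eqr_oppLR opprB => /eqP; exists c.
Qed.

Lemma mx_norm_le (R : realType) m n (A : 'M[R]_(m, n)) (e : R) : 0 <= e ->
  (forall i j, `|A i j| <= e) -> `|A| <= e.
Proof.
move=> e0 Ae; rewrite [leLHS]/Num.Def.normr/= mx_normrE.
by apply: bigmax_le => // -[i j] _; exact: Ae.
Qed.

Lemma le_mx_norm (R : realType) m n (A : 'M[R]_(m, n)) i j : `|A i j| <= `|A|.
Proof.
rewrite [leRHS]/Num.Def.normr/= mx_normrE.
exact: (le_bigmax _ (fun ij => `|A ij.1 ij.2|) (i, j)).
Qed.

Lemma derive_line (R : realType) (V W : normedModType R) (f : V -> W) x v t :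
  derivable f (x + t *: v) v ->
  is_derive t (1 : R) (fun s : R => f (x + s *: v)) ('D_v f (x + t *: v)).
Proof.
move=> df.
have E : (fun h => h^-1 *: ((f \o shift (x + t *: v)) (h *: v) - f (x + t *: v)))
  = (fun h => h^-1 *: (((fun s : R => f (x + s *: v)) \o shift t) (h *: (1 : R))
       - f (x + t *: v))).
  apply/funext => h /=; congr (_ *: (f _ - _)).
  by rewrite [h *: 1]mulr1 scalerDl addrCA.
by apply: DeriveDef; rewrite /derivable /derive -E.
Qed.

Section C1.
Context {R : realType} {n : nat}.
Implicit Types (f : 'rV[R]_n -> R) (x h v : 'rV[R]_n).

Let trunc h (j : nat) : 'rV[R]_n := \row_i (if (i < j)%N then h 0 i else 0).

Let trunc_line h (j : 'I_n) (t : R) : `|t| <= `|h 0 j| ->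
  `|trunc h j + t *: basis_vec R j| <= `|h|.
Proof.
move=> tj; apply: mx_norm_le => // i k; rewrite !mxE !ord1 /=.
have [->|kj] := eqVneq k j.
  by rewrite ltnn add0r mulr1 (le_trans tj)// le_mx_norm.
by rewrite mulr0 addr0; case: ifP; rewrite ?le_mx_norm ?normr0.
Qed.

Let truncS h (j : 'I_n) : trunc h j.+1 = trunc h j + h 0 j *: basis_vec R j.
Proof.
apply/rowP => k; rewrite !mxE eqxx /= ltnS leq_eqVlt.
have [->|kj] := eqVneq k j; first by rewrite eqxx ltnn add0r mulr1.
by rewrite (negbTE kj : (k == j :> nat) = false) mulr0 addr0.
Qed.

(** The increment is split along a path that changes one coordinate at a time. In the sup norm this
    path stays within [|h|] of [x], and the mean value theorem on each leg compares the increment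
    with the partial derivative at [x]. *)
Lemma differentiable_C1 f x :
  (\forall y \near x, forall i, derivable f y (basis_vec R i)) ->
  (forall i, {for x, continuous ('D_(basis_vec R i) f)}) ->
  differentiable f x.
Proof.
move=> df cf.
pose c : 'cV[R]_n := \col_i 'D_(basis_vec R i) f x.
pose L h : R := (h *m c) 0 0.
have Llin : linear L by move=> a u v; rewrite /L mulmxDl -scalemxAl !mxE.
pose LL := GRing.isLinear.Build R 'rV[R]_n R *:%R L Llin.
pose df' : {linear 'rV[R]_n -> R} := HB.pack L LL.
have Lc : continuous df'.
  move=> y; rewrite /df'/= /L.
  have -> : (fun h : 'rV[R]_n => (h *m c) 0 0) = fun h => \sum_i h 0 i * c i 0.
    by apply/funext => h; rewrite mxE.
  apply: (@cvg_sumr _ _ _ (nbhs y)) => i _.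
  by apply: cvgMr_tmp; exact: coord_continuous.
(* The differential is chosen among the linear maps with the right expansion, so exhibiting one,
   [df'], suffices. *)
apply/diffP; apply: (@getPex _ (fun (df : {linear 'rV[R]_n -> R}) =>
  continuous df /\ forall y, f y = f (lim (nbhs x)) + df (y - lim (nbhs x))
                  +o_(y \near x) (y - lim (nbhs x)))).
exists df'; split=> //; rewrite lim_id//.
apply/eqaddoEx/funeqP; apply/eqaddoP => e e0.
(* Each of the [n] legs will cost at most [e' * |h|]; the successor keeps the quotient meaningful
   for [n = 0]. *)
pose e' := e / n.+1%:R.
have e'0 : 0 < e' by rewrite divr_gt0.
have : \forall y \near x, (forall i, derivable f y (basis_vec R i)) /\
    forall i, `|'D_(basis_vec R i) f x - 'D_(basis_vec R i) f y| <= e'.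
  near=> y; split; first by near: y.
  by near: y; apply: filter_forall => i; move/cvgrPdist_le : (cf i); exact.
move=> /nbhs_ballP[d /= d0 xd].
near=> y.
have xyd : `|y - x| < d by rewrite distrC; near: y; exact: cvgr_dist_lt.
set h := y - x.
have yE : y = x + h by rewrite /h addrC subrK.
have step (j : 'I_n) :
    `|f (x + trunc h j.+1) - f (x + trunc h j) - h 0 j * c j 0| <= e' * `|h|.
  have hd t : `|t| <= `|h 0 j| -> ball x d (x + (trunc h j + t *: basis_vec R j)).
    move=> th; rewrite -ball_normE/= opprD addNKr normrN.
    exact: le_lt_trans (trunc_line th) xyd.
  pose phi (t : R) := f (x + trunc h j + t *: basis_vec R j).
  have dphi t : `|t| <= `|h 0 j| -> is_derive t (1 : R) phi
      ('D_(basis_vec R j) f (x + trunc h j + t *: basis_vec R j)).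
    by move=> th; apply: derive_line; rewrite -addrA; exact: (xd _ (hd _ th)).1.
  have [t th] := mean_value_centered dphi.
  rewrite /phi scale0r addr0 -addrA -truncS => ->.
  rewrite [c j 0]mxE [h 0 j * _]mulrC -mulrBl normrM distrC -!addrA.
  by apply: ler_pM => //; [exact: (xd _ (hd _ th)).2 | exact: le_mx_norm].
have tele : f y - f x = \sum_(j < n) (f (x + trunc h j.+1) - f (x + trunc h j)).
  rewrite -(big_mkord xpredT (fun j => f (x + trunc h j.+1) - f (x + trunc h j))).
  rewrite telescope_sumr//; congr (f _ - f _).
    by rewrite yE; congr (_ + _); apply/rowP => i; rewrite [RHS]mxE ltn_ord.
  by rewrite -[LHS]addr0; congr (_ + _); apply/rowP => i; rewrite !mxE.
rewrite /= !fctE opprD addrA tele /df'/= /L mxE -sumrB.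
apply: (le_trans (ler_norm_sum _ _ _)).
apply: (@le_trans _ _ (\sum_(j < n) e' * `|h|)); first exact: ler_sum.
rewrite sumr_const card_ord -mulr_natr mulrAC ler_wpM2r// /e'.
by rewrite -mulrA ler_piMr ?(ltW e0)// mulrC ler_pdivrMr// mul1r ler_nat.
Unshelve. all: by end_near. Qed.
End C1.

Lemma near_eq_continuous (T U : topologicalType) (f g : T -> U) (x : T) :
  (\forall y \near x, f y = g y) -> {for x, continuous f} ->
  {for x, continuous g}.
Proof.
move=> fg; rewrite /prop_for /continuous_at -(nbhs_singleton fg) => fx.
by apply: cvg_trans fx; apply: near_eq_cvg; apply: filterS fg => y.
Qed.

Section Directional.
Context {R : realType} {n : nat}.
Implicit Types (f : 'rV[R]_n -> R) (x v : 'rV[R]_n).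
Local Notation e := (@basis_vec R n).

Lemma differentiable_C1_with f (df : 'I_n -> 'rV[R]_n -> R) x :
  (\forall y \near x, forall i, is_derive y (e i) f (df i y)) ->
  (forall i, {for x, continuous (df i)}) -> differentiable f x.
Proof.
move=> fdf cdf; apply: differentiable_C1.
  by apply: filterS fdf => y dfy i; have [] := dfy i.
move=> i; apply: near_eq_continuous (cdf i).
by apply: filterS fdf => y dfy; have [] := dfy i.
Qed.

Lemma derive_sum_basis f x v : differentiable f x ->
  'D_v f x = \sum_i v 0 i * 'D_(e i) f x.
Proof.
move=> df; rewrite deriveE// [v in LHS]row_sum_delta linear_sum.
by apply: eq_bigr => i _; rewrite linearZ/= deriveE.
Qed.

(** [Phi] is only derivable along [w], so everything is restricted to the line through [z] in
    direction [w], where derivability is differentiability and the chain rule applies. *)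
Lemma is_derive_comp (V : normedModType R) f (Phi : V -> 'rV[R]_n) (z w : V) :
  differentiable f (Phi z) ->
  (forall j, derivable (fun y => Phi y 0 j) z w) ->
  is_derive z w (f \o Phi)
    (\sum_j 'D_w (fun y => Phi y 0 j) z * 'D_(e j) f (Phi z)).
Proof.
move=> df dPhi.
have dP : derivable Phi z w by apply/derivable_mxP => i j; rewrite !ord1.
have d1 : differentiable (fun h : R => Phi (h *: w + z)) 0.
  exact/derivable1_diffP/(derivable1P Phi z w).1.
have d2 : differentiable f (Phi (0 *: w + z)) by rewrite scale0r add0r.
have d3 : derivable (f \o Phi) z w.
  apply/(derivable1P (f \o Phi))/derivable1_diffP.
  exact: (@differentiable_comp _ _ _ _ (fun h : R => Phi (h *: w + z)) f).
apply: DeriveDef => //.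
have E (W : normedModType R) (g : V -> W) : derivable g z w ->
    'D_w g z = 'D_(1 : R) (fun h : R => g (h *: w + z)) 0.
  move=> dg; rewrite -[z in LHS]addr0 -[0 in LHS](scale0r w).
  have -> : (fun h : R => g (h *: w + z)) = (fun h : R => g (z + h *: w)).
    by apply/funext => h; rewrite addrC.
  by apply/esym/derive_val/derive_line; rewrite scale0r addr0.
rewrite E// deriveE; last first.
  exact: (@differentiable_comp _ _ _ _ (fun h : R => Phi (h *: w + z)) f).
rewrite (@diff_comp _ _ _ _ (fun h : R => Phi (h *: w + z)) f)//=.
rewrite -[X in 'd f _ X]deriveE// -E// scale0r add0r -deriveE//.
rewrite derive_sum_basis//; apply: eq_bigr => j _.
by rewrite derive_mx// mxE.
Qed.

End Directional.

(** * Hopf's strong maximum principle *)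

Lemma inner_row_mx (R : realType) m1 m2 (a : 'M[R]_m1) b c (d : 'M[R]_m2) u1 u2 :
  inner (block_mx a b c d) (row_mx u1 u2) (row_mx u1 u2) =
  inner a u1 u1 + (u2 *m c *m u1^T) 0 0 + (u1 *m b *m u2^T) 0 0 + inner d u2 u2.
Proof.
have mxD (X Y : 'M[R]_1) : (X + Y) 0 0 = X 0 0 + Y 0 0 by rewrite mxE.
by rewrite /inner mul_row_block tr_row_mx mul_row_col !mulmxDl !mxD addrA.
Qed.

(** Induction by Schur complement. If P has first row (c, r) and lower block P', put S = P' - c^-1
    r^T r; then tr(PH) = tr(SH') + c^-1 <(c, r)H, (c, r)>. The first term is handled by induction,
    the second by the sign of H. *)
Lemma psd_trace_le0 (R : realType) m (P H : 'M[R]_m) :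
  P^T = P -> (forall v : 'rV_m, v != 0 -> 0 < inner P v v) ->
  (forall v : 'rV_m, inner H v v <= 0) -> \tr (P *m H) <= 0.
Proof.
elim: m P H => [|m IH] P H; first by move=> _ _ _; rewrite /mxtrace big_ord0.
move: P H; rewrite -add1n => P H.
rewrite -[P]submxK -[H]submxK.
move: (ulsubmx P) (ursubmx P) (dlsubmx P) (drsubmx P) => p r q P'.
move: (ulsubmx H) (ursubmx H) (dlsubmx H) (drsubmx H) => h1 h2 h3 H'.
rewrite tr_block_mx => /eq_block_mx[_ _ <- P'E] Ppos Hneg.
have pE : p = (p 0 0)%:M by exact: mx11_scalar.
set c := p 0 0 in pE.
have c0 : 0 < c.
  have /Ppos : row_mx 1 0 != 0 :> 'rV[R]_(1 + m).
    apply/eqP => /(congr1 (fun x : 'rV_(1+m) => x 0 (lshift m 0))).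
    by rewrite row_mxEl !mxE => /eqP; rewrite oner_eq0.
  rewrite inner_row_mx /inner trmx0 !mulmx0 !mul0mx !mxE !addr0 pE.
  by rewrite big_ord1 !mxE big_ord1 !mxE eqxx mul1r mulr1.
pose S := P' - c^-1 *: (r^T *m r).
have PS : P' = S + c^-1 *: (r^T *m r) by rewrite subrK.
have trS : \tr (S *m H') <= 0.
  apply: IH.
  - by rewrite /S linearB/= linearZ/= trmx_mul trmxK P'E.
  - move=> v v0.
    (* This first coordinate minimises the quadratic form of P over vectors ending in [v]; the
       minimum is the form of S at [v]. *)
    have /Ppos : row_mx (- c^-1 *: (v *m r^T)) v != 0 :> 'rV[R]_(1 + m).
      apply: contra v0 => /eqP /(congr1 rsubmx); rewrite row_mxKr => ->.
      by rewrite linear0.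
    rewrite inner_row_mx.
    have vrE : v *m r^T = ((v *m r^T) 0 0)%:M by exact: mx11_scalar.
    set s := (_ *m _) 0 0 in vrE.
    have rvE : r *m v^T = s%:M by rewrite -[LHS]trmxK trmx_mul trmxK vrE tr_scalar_mx.
    have -> : inner P' v v = inner S v v + c^-1 * s ^+ 2.
      rewrite PS /inner mulmxDr mulmxDl mxE -scalemxAr -scalemxAl mulmxA vrE.
      by rewrite -[s%:M *m _ *m _]mulmxA rvE -scalar_mxM !mxE eqxx expr2.
    rewrite /inner -[_ *m r *m _]mulmxA rvE vrE pE scale_scalar_mx tr_scalar_mx.
    rewrite -!scalar_mxM !mxE !eqxx.
    rewrite !mulr1n; set Z := \sum_j _; clearbody Z s c; congr (0 < _); field.
    by rewrite gt_eqF.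
  - move=> v; have := Hneg (row_mx 0 v).
    by rewrite inner_row_mx /inner trmx0 !mulmx0 !mul0mx !mxE !add0r.
have := Hneg (row_mx p r); rewrite inner_row_mx.
rewrite -(pmulr_rle0 _ (_ : 0 < c^-1)) ?invr_gt0// => Hu.
rewrite mulmx_block mxtrace_block !mxtraceD PS mulmxDl mxtraceD.
rewrite -scalemxAl mxtraceZ.
rewrite [\tr (r^T *m h2)]mxtrace_mulC -[r^T *m r *m H']mulmxA [\tr (r^T *m _)]mxtrace_mulC.
rewrite /mxtrace !big_ord1.
move: Hu trS; rewrite /inner pE tr_scalar_mx !mul_mx_scalar !mul_scalar_mx -!scalemxAl !mxE.
set s1 := h1 0 0; set s2 := \sum_j _; set s3 := \sum_j _; set s4 := \sum_j _.
rewrite -/(mxtrace _) => Hu trS.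
have -> : c * s1 + s2 + (s3 + (\tr (S *m H') + c^-1 * s4)) =
    \tr (S *m H') + c^-1 * (c * (c * s1) + c * s2 + c * s3 + s4).
  by clearbody c s1 s2 s3 s4; field; rewrite gt_eqF.
by rewrite -[leRHS]addr0 lerD.
Qed.

(** * Second order conditions at a maximum *)

Section C2.
Context {R : realType} {m : nat}.
Implicit Types (O : set 'rV[R]_m) (w : 'rV[R]_m -> R) (x y z v : 'rV[R]_m).
Local Notation e := (@basis_vec R m).

(** The derivatives are carried as named functions, so that those of [u + c *: barrier] are explicit
    combinations. [W2 i j] differentiates along [i] first, then along [j]. *)
Definition C2_with O w (W1 : 'I_m -> 'rV[R]_m -> R)
    (W2 : 'I_m -> 'I_m -> 'rV[R]_m -> R) :=
  forall y, O y -> [/\ forall i, is_derive y (e i) w (W1 i y),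
    forall i, {for y, continuous (W1 i)},
    forall i j, is_derive y (e j) (W1 i) (W2 i j y)
    & forall i j, {for y, continuous (W2 i j)}].

Lemma C2_with_differentiable O w W1 W2 x : open O -> O x -> C2_with O w W1 W2 ->
  differentiable w x /\ forall i, differentiable (W1 i) x.
Proof.
move=> oO Ox c2; split=> [|i].
  apply: (differentiable_C1_with (df := W1)); last by have [] := c2 x Ox.
  by apply: filterS (open_nbhs_nbhs (conj oO Ox)) => y /c2[].
apply: (differentiable_C1_with (df := W2 i)) => [|j].
  by apply: filterS (open_nbhs_nbhs (conj oO Ox)) => y /c2[].
by have [_ _ _] := c2 x Ox; apply.
Qed.

Lemma C2_with_line O w W1 W2 x v : open O -> O x -> C2_with O w W1 W2 ->
  is_derive x v w (\sum_i v 0 i * W1 i x) /\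
  is_derive x v (fun y => \sum_i v 0 i * W1 i y)
    (\sum_i \sum_j v 0 i * v 0 j * W2 i j x).
Proof.
move=> oO Ox c2; have [dw dW1] := C2_with_differentiable oO Ox c2.
have [d1 _ d2 _] := c2 x Ox; split.
  apply: DeriveDef; first exact: diff_derivable.
  rewrite derive_sum_basis//; apply: eq_bigr => i _.
  by rewrite (@derive_val _ _ _ _ _ _ _ (d1 i)).
have -> : (fun y => \sum_i v 0 i * W1 i y) = \sum_i (v 0 i *: W1 i).
  by apply/funext => y; rewrite fct_sumE.
apply: is_derive_sum => i.
have dv : derivable (W1 i) x v by exact: diff_derivable.
apply: is_derive_eq (is_deriveZ (v 0 i) (derivableP dv)) _.
rewrite derive_sum_basis// scaler_sumr; apply: eq_bigr => j _.
by rewrite (@derive_val _ _ _ _ _ _ _ (d2 i j)) /GRing.scale/= mulrA.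
Qed.

(** If the second derivative along [v] were positive, the first one, zero at [x], would be positive
    just after [x], and the mean value theorem would produce a value above the maximum. *)
Lemma C2_with_max O w W1 W2 x : open O -> O x -> C2_with O w W1 W2 ->
  (forall y, O y -> w y <= w x) ->
  (forall v, \sum_i v 0 i * W1 i x = 0) /\
  (forall v, \sum_i \sum_j v 0 i * v 0 j * W2 i j x <= 0).
Proof.
move=> oO Ox c2 wmax.
have line v : exists2 d : R, 0 < d & forall t : R, `|t| < d -> O (x + t *: v).
  have : (fun t : R => x + t *: v) t @[t --> (0 : R)] --> x.
    rewrite -[X in _ --> X]addr0 -[X in _ + X](scale0r v).
    by apply: cvgD; [exact: cvg_cst | exact: cvgZr_tmp].
  move=> /(_ O (open_nbhs_nbhs (conj oO Ox))) /nbhs_ballP[d /= d0 dO].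
  by exists d => // t td; apply: dO; rewrite -ball_normE/= sub0r normrN.
pose D1 v y := \sum_i v 0 i * W1 i y.
have dline v t : O (x + t *: v) ->
    is_derive t (1 : R) (fun s => w (x + s *: v)) (D1 v (x + t *: v)).
  move=> Oy; have [dw _] := C2_with_line v oO Oy c2.
  apply: is_derive_eq (derive_line _) _; first exact: ex_derive.
  exact: derive_val.
have D1x v : D1 v x = 0.
  have [d d0 dO] := line v.
  have : is_derive (0 : R) (1 : R) (fun s : R => w (x + s *: v)) 0.
    apply: (@derive1_at_max _ _ (- d) d); first by lra.
    - move=> t; rewrite in_itv/= -ltr_norml => /dO/dline dt; exact: ex_derive.
    - by rewrite in_itv/= oppr_lt0 d0.
    - move=> t; rewrite in_itv/= -ltr_norml => /dO/wmax.
      by rewrite scale0r addr0.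
  move=> /(@derive_val _ _ _ _ _ _ _) <-.
  have := @dline v 0; rewrite scale0r addr0 => /(_ Ox) dl.
  by rewrite (@derive_val _ _ _ _ _ _ _ dl).
split=> // v; rewrite leNgt; apply/negP.
set Q := \sum_i _ => Q0.
have [d d0 dO] := line v.
have [_ dD1] := C2_with_line v oO Ox c2.
have dpsi : is_derive (0 : R) (1 : R) (fun s : R => D1 v (x + s *: v)) Q.
  apply: is_derive_eq (derive_line _) _.
    by rewrite scale0r addr0; exact: ex_derive.
  by rewrite scale0r addr0; exact: derive_val.
have : \forall t \near (0 : R)^', 0 < t^-1 * D1 v (x + t *: v).
  have [dl dQ] := dpsi.
  have : (fun h => h^-1 *: (((fun s : R => D1 v (x + s *: v)) \o shift 0) (h *: (1 : R))
      - D1 v (x + 0 *: v))) @ 0^' --> Q by rewrite -[Q]dQ; exact: dl.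
  move=> /(cvgr_gt _)/(_ 0 Q0)[r /= r0 rP].
  exists r => // t tr t0; have := rP t tr t0.
  by rewrite /= scale0r !addr0 D1x subr0 [t *: 1]mulr1.
move=> [r /= r0 rP].
pose s := Num.min d r / 2.
have s0 : 0 < s by rewrite divr_gt0// lt_min d0.
have sd : s < d by rewrite /s ltr_pdivrMr// gt_min ltr_pMr// ltr1n.
have sr : s < r.
  by rewrite /s ltr_pdivrMr// gt_min orbC ltr_pMr// ltr1n.
have ball_s t : 0 <= t <= s -> O (x + t *: v).
  by move=> /andP[t0 ts]; apply: dO; rewrite ger0_norm// (le_lt_trans ts).
have [t|t|t /[!in_itv]/= /andP[t0 ts]] :=
    @MVT R (fun s => w (x + s *: v)) (fun s => D1 v (x + s *: v)) 0 s s0.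
- rewrite in_itv/= => /andP[/ltW t0 /ltW ts].
  by apply: dline; apply: ball_s; rewrite t0.
- apply: continuous_in_subspaceT => {}t; rewrite inE/= in_itv/= => /ball_s/dline dt.
  by apply/differentiable_continuous/derivable1_diffP; exact: ex_derive.
have : 0 < D1 v (x + t *: v).
  rewrite -(pmulr_rgt0 _ (_ : 0 < t^-1)) ?invr_gt0//; apply: rP; last by rewrite gt_eqF.
  by rewrite /= sub0r normrN gtr0_norm// (lt_trans ts).
rewrite scale0r addr0 subr0 => D1t /eqP; rewrite subr_eq => /eqP wE.
have /wmax : O (x + s *: v) by apply: ball_s; rewrite lexx ltW.
by rewrite wE gerDr leNgt mulr_gt0.
Qed.

End C2.

Lemma coord_cvg (R : realType) m (x : 'rV[R]_m) i :
  (fun y : 'rV[R]_m => y 0 i) y @[y --> x] --> x 0 i.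
Proof. exact: coord_continuous. Qed.

Lemma is_derive_coord (R : realType) m (x v : 'rV[R]_m) i :
  is_derive x v (fun y : 'rV[R]_m => y 0 i) (v 0 i).
Proof.
have dx : derivable (@id 'rV[R]_m) x v by exact: derivable_id.
have /derivable_mxP/(_ 0 i) d := dx; apply: DeriveDef => //.
have := derive_mx dx; rewrite derive_id => /(congr1 (fun y : 'rV_m => y 0 i)).
by rewrite mxE.
Qed.

(* phi x = (x - y).(x - z) is nonpositive exactly on the ball of diameter [y, z]; *)
(* near z the barrier is negative where phi > 0, and a large B makes it a strict  *)
(* subsolution, phi having nonzero gradient z - y at z.                           *)
Section Barrier.
Context {R : realType} {m : nat} (y z : 'rV[R]_m) (B : R).
Implicit Types x : 'rV[R]_m.
Local Notation e := (@basis_vec R m).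

Let phi x : R := \sum_k (x 0 k - y 0 k) * (x 0 k - z 0 k).
Let P (i : 'I_m) x : R := x 0 i - y 0 i + (x 0 i - z 0 i).

Let phiD i x : is_derive x (e i) phi (P i x).
Proof.
have -> : phi = \sum_k (fun x => (x 0 k - y 0 k) * (x 0 k - z 0 k)).
  by apply/funext => t; rewrite fct_sumE.
have d k (c : R) : is_derive x (e i) (fun x => x 0 k - c) ((k == i)%:R).
  apply: is_derive_eq (is_deriveB (is_derive_coord x (e i) k) (is_derive_cst c x (e i))) _.
  by rewrite mxE eqxx subr0.
have dk k := is_deriveM (d k (y 0 k)) (d k (z 0 k)).
apply: is_derive_eq (is_derive_sum dk) _.
rewrite (bigD1 i)//= eqxx big1 ?addr0 => [|k ki].
  by rewrite /GRing.scale/= !mulr1.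
by rewrite (negbTE ki) /GRing.scale/= !mulr0 addr0.
Qed.

Let PD i j x : is_derive x (e j) (P i) (2 * (i == j)%:R).
Proof.
have d (c : R) := is_deriveB (is_derive_coord x (e j) i) (is_derive_cst c x (e j)).
apply: is_derive_eq (is_deriveD (d (y 0 i)) (d (z 0 i))) _.
by rewrite mxE eqxx !subr0 mulr_natl.
Qed.

Let phi_cont x : phi t @[t --> x] --> phi x.
Proof.
apply: (@cvg_sumr _ _ _ (nbhs x)) => k _.
by apply: (@cvgM _ _ (nbhs x)); apply: (@cvgB _ _ _ (nbhs x));
  [exact: coord_cvg|exact: cvg_cst|exact: coord_cvg|exact: cvg_cst].
Qed.

Let P_cont i x : P i t @[t --> x] --> P i x.
Proof.
by rewrite /P; apply: (@cvgD _ _ _ (nbhs x));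
  apply: (@cvgB _ _ _ (nbhs x)); [exact: coord_cvg|exact: cvg_cst|exact: coord_cvg|exact: cvg_cst].
Qed.

Definition barrier x := phi x * (B * phi x - 1).

Definition barrier1 i x := (2 * B * phi x - 1) * P i x.

Definition barrier2 i j x :=
  2 * B * P j x * P i x + (2 * B * phi x - 1) * (2 * (i == j)%:R).

Lemma barrier_C2 (O : set 'rV[R]_m) : C2_with O barrier barrier1 barrier2.
Proof.
move=> x _.
have dc i (c : R) : is_derive x (e i) (fun x => c * phi x - 1) (c * P i x).
  have -> : (fun x => c * phi x - 1) = c *: phi - cst 1 by [].
  have := is_deriveB (is_deriveZ c (phiD i x)) (is_derive_cst (1 : R) x (e i)).
  move=> /is_derive_eq; apply.
  by rewrite subr0.
have cc (c : R) : (c * phi t - 1) @[t --> x] --> c * phi x - 1.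
  apply: (@cvgB _ _ _ (nbhs x)); last exact: cvg_cst.
  by apply: (@cvgMl_tmp _ _ (nbhs x)); exact: phi_cont.
split.
- move=> i; apply: is_derive_eq (is_deriveM (phiD i x) (dc i B)) _.
  by rewrite /barrier1 /GRing.scale/=; ring.
- by move=> i; exact: cvgM (cc _) (@P_cont i x).
- move=> i j; apply: is_derive_eq (is_deriveM (dc j (2 * B)) (PD i j x)) _.
  by rewrite /barrier2 /GRing.scale/=; ring.
- move=> i j; apply: (@cvgD _ _ _ (nbhs x)).
    exact: cvgM (cvgMl_tmp (P_cont (i:=j) (x:=x))) (P_cont (i:=i) (x:=x)).
  by apply: (@cvgMr_tmp _ _ (nbhs x)); exact: cc.
Qed.

Lemma barrier_eq0 : barrier z = 0.
Proof. by rewrite /barrier /phi big1 ?mul0r// => k _; rewrite subrr mulr0. Qed.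

End Barrier.

Section Hopf.
Context {R : realType} {m : nat}.
Implicit Types (O : set 'rV[R]_m) (u : 'rV[R]_m -> R) (x y z : 'rV[R]_m).
Local Notation e := (@basis_vec R m).

Definition dot (x y : 'rV[R]_m) : R := \sum_k x 0 k * y 0 k.

Lemma C2_with_comb O (w v : 'rV[R]_m -> R) W1 W2 V1 V2 (c : R) :
  C2_with O w W1 W2 -> C2_with O v V1 V2 ->
  C2_with O (w + c *: v) (fun i => W1 i + c *: V1 i)
    (fun i j => W2 i j + c *: V2 i j).
Proof.
move=> c2w c2v x Ox; have [a1 a2 a3 a4] := c2w x Ox.
have [b1 b2 b3 b4] := c2v x Ox; split.
- by move=> i; exact: is_deriveD (a1 i) (is_deriveZ c (b1 i)).
- by move=> i; exact: cvgD (a2 i) (cvgZl_tmp (b2 i)).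
- by move=> i j; exact: is_deriveD (a3 i j) (is_deriveZ c (b3 i j)).
- by move=> i j; exact: cvgD (a4 i j) (cvgZl_tmp (b4 i j)).
Qed.

Definition elliptic_coeffs O (a : 'rV[R]_m -> 'M[R]_m) (b : 'rV[R]_m -> 'rV[R]_m) :=
  forall x, O x -> [/\ (a x)^T = a x, forall v, v != 0 -> 0 < inner (a x) v v,
    forall i j, {for x, continuous (fun t => a t i j)}
    & forall k, {for x, continuous (fun t => b t 0 k)}].

Definition elliptic_op (a : 'rV[R]_m -> 'M[R]_m) (b : 'rV[R]_m -> 'rV[R]_m)
    (W1 : 'I_m -> 'rV[R]_m -> R) (W2 : 'I_m -> 'I_m -> 'rV[R]_m -> R) x : R :=
  \sum_i \sum_j a x i j * W2 i j x - \sum_k b x 0 k * W1 k x.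

Lemma elliptic_op_max O a b w W1 W2 x : open O -> O x ->
  elliptic_coeffs O a b -> C2_with O w W1 W2 ->
  (forall y, O y -> w y <= w x) -> elliptic_op a b W1 W2 x <= 0.
Proof.
move=> oO Ox ell c2 wmax; have [asym apos _ _] := ell x Ox.
have [W1x W2x] := C2_with_max oO Ox c2 wmax.
have bE : \sum_k b x 0 k * W1 k x = 0 := W1x (b x).
rewrite /elliptic_op bE subr0.
pose H : 'M[R]_m := \matrix_(j, i) W2 i j x.
have -> : \sum_i \sum_j a x i j * W2 i j x = \tr (a x *m H).
  rewrite /mxtrace; apply: eq_bigr => i _; rewrite mxE.
  by apply: eq_bigr => j _; rewrite mxE.
apply: psd_trace_le0 => // v.
rewrite (_ : inner H v v = \sum_i \sum_j v 0 i * v 0 j * W2 i j x)//.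
rewrite /inner mxE; apply: eq_bigr => i _; rewrite mxE mulr_suml.
by apply: eq_bigr => j _; rewrite !mxE; ring.
Qed.

Lemma elliptic_op_comb a b W1 W2 V1 V2 (c : R) x :
  elliptic_op a b (fun i => W1 i + c *: V1 i) (fun i j => W2 i j + c *: V2 i j) x =
  elliptic_op a b W1 W2 x + c * elliptic_op a b V1 V2 x.
Proof.
rewrite /elliptic_op mulrBr addrACA -opprD; congr (_ - _).
  rewrite mulr_sumr -big_split; apply: eq_bigr => i _ /=.
  rewrite mulr_sumr -big_split; apply: eq_bigr => j _ /=.
  by rewrite -[(W2 i j + _) x]/(W2 i j x + c * V2 i j x); ring.
rewrite mulr_sumr -big_split; apply: eq_bigr => i _ /=.
by rewrite -[(W1 i + _) x]/(W1 i x + c * V1 i x); ring.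
Qed.

Lemma elliptic_op_cont O a b w W1 W2 x : O x -> elliptic_coeffs O a b ->
  C2_with O w W1 W2 -> {for x, continuous (elliptic_op a b W1 W2)}.
Proof.
move=> Ox ell c2; have [_ _ ca cb] := ell x Ox; have [_ c1 _ c2'] := c2 x Ox.
apply: (@cvgB _ _ _ (nbhs x)).
  apply: (@cvg_sumr _ _ _ (nbhs x)) => i _; apply: (@cvg_sumr _ _ _ (nbhs x)) => j _.
  exact: cvgM (ca i j) (c2' i j).
apply: (@cvg_sumr _ _ _ (nbhs x)) => i _.
exact: cvgM (cb i) (c1 i).
Qed.

(** Since phi vanishes at [z], the operator there equals 2BA + C, where A > 0 is the form of [a z]
    at z - y and C does not depend on B. With B = (|C| + 1)/A this is 2|C| + 2 + C > 0. *)
Lemma barrier_op (O : set 'rV[R]_m) a b y z : O z -> elliptic_coeffs O a b -> y != z ->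
  exists2 B, 0 < B & 0 < elliptic_op a b (barrier1 y z B) (barrier2 y z B) z.
Proof.
move=> Oz ell yz; have [_ apos _ _] := ell z Oz.
pose p := z - y.
have p0 : p != 0 by rewrite subr_eq0 eq_sym.
have A0 := apos p p0; set A := inner _ _ _ in A0.
pose C : R := - \sum_i \sum_j a z i j * (2 * (i == j)%:R) + \sum_k b z 0 k * p 0 k.
exists ((`|C| + 1) / A); first by rewrite divr_gt0// ltr_wpDl.
set B := _ / A.
have phi0 : \sum_k (z 0 k - y 0 k) * (z 0 k - z 0 k) = 0.
  by rewrite big1// => k _; rewrite subrr mulr0.
suff -> : elliptic_op a b (barrier1 y z B) (barrier2 y z B) z = 2 * B * A + C.
  rewrite /B mulrA divfK ?gt_eqF//.
  by have := ler_norm (- C); rewrite normrN; have := normr_ge0 C; lra.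
rewrite /elliptic_op /C addrA; congr (_ + _); last first.
  rewrite -sumrN; apply: eq_bigr => k _; rewrite /barrier1 phi0 !mxE; ring.
have -> : A = \sum_i \sum_j a z i j * p 0 i * p 0 j.
  rewrite /A /inner mxE exchange_big; apply: eq_bigr => j _.
  by rewrite mxE mulr_suml; apply: eq_bigr => i _; rewrite [_^T _ _]mxE; ring.
rewrite mulr_sumr -sumrN -big_split; apply: eq_bigr => i _ /=.
rewrite mulr_sumr -sumrN -big_split; apply: eq_bigr => j _ /=.
by rewrite /barrier2 phi0 !mxE; ring.
Qed.

Lemma closed_ball_compact z (d : R) : compact [set x | `|x - z| <= d].
Proof.
apply: bounded_closed_compact.
  exists (d + `|z|); split; first exact: num_real.
  move=> M dM x /= xd; apply: ltW; apply: le_lt_trans dM.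
  by rewrite -[x](subrK z) (le_trans (ler_normD _ _))// lerD2r.
have -> : [set x | `|x - z| <= d] = (fun x => `|x - z|) @^-1` [set t : R | t <= d] by [].
apply: preimage_closed; last exact: closed_le.
move=> x _; apply: (@cvg_norm _ _ _ (nbhs x)).
by apply: (@cvgB _ _ _ (nbhs x)); [exact: cvg_id | exact: cvg_cst].
Qed.

Lemma perturbation_lt (T : topologicalType) (E : set T) (f g : T -> R) (M : R) :
  compact E -> {within E, continuous f} -> {within E, continuous g} ->
  (forall x : T, E x -> f x < M) ->
  exists2 c, 0 < c & forall x : T, E x -> f x + c * g x < M.
Proof.
move=> cE cf cg fM.
have [E0|/set0P En] := eqVneq E set0.
  by exists 1 => // x; rewrite E0.
have [s /set_mem sE sP] := compact_EVT_max En cE cf.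
have [t /set_mem tE tP] := compact_EVT_max En cE cg.
have fs := fM s sE.
have V0 : 0 < `|g t| + 1 by rewrite ltr_wpDl.
(* The uniform gap M - max f, divided by a bound exceeding max g. *)
exists ((M - f s) / (`|g t| + 1)); first by rewrite divr_gt0// subr_gt0.
move=> x Ex; have /mem_set xE := Ex.
set c := _ / _; have c0 : 0 < c by rewrite divr_gt0// subr_gt0.
have cE' : c * (`|g t| + 1) = M - f s by rewrite divfK// gt_eqF.
have : c * g x <= c * `|g t|.
  by rewrite ler_pM2l// (le_trans (tP x xE))// ler_norm.
by have := sP x xE; lra.
Qed.

(** Hopf's comparison: [u] stays below M on the closed ball with diameter [y, z] except at [z].
    Adding a small multiple of the barrier keeps the value M at [z] and pushes the function below M
    on the boundary of a small cube around [z]. Its maximum over the cube is then interior, at a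
    point where the operator is positive, against [elliptic_op_max]. *)
Lemma no_interior_touch O a b u U1 U2 (M : R) y z : open O -> O z -> y != z ->
  elliptic_coeffs O a b -> C2_with O u U1 U2 ->
  (forall x, O x -> elliptic_op a b U1 U2 x = 0) ->
  u z = M -> (forall x, O x -> u x <= M) ->
  (forall x, O x -> x != z -> dot (x - y) (x - z) <= 0 -> u x < M) -> False.
Proof.
move=> oO Oz yz ell c2u Lu uz uM touch.
have [B B0 LB] := barrier_op Oz ell yz.
have c2v := @barrier_C2 _ _ y z B O.
pose phi x := dot (x - y) (x - z).
have phi_cont : continuous phi.
  move=> x; apply: (@cvg_sumr _ _ _ (nbhs x)) => k _; rewrite !mxE.
  apply: (@cvgM _ _ (nbhs x)).
    have -> : (fun t : 'rV[R]_m => (t - y) 0 k) = fun t => t 0 k - y 0 k.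
      by apply/funext => t; rewrite !mxE.
    by apply: (@cvgB _ _ _ (nbhs x)); [exact: coord_cvg | exact: cvg_cst].
  have -> : (fun t : 'rV[R]_m => (t - z) 0 k) = fun t => t 0 k - z 0 k.
    by apply/funext => t; rewrite !mxE.
  by apply: (@cvgB _ _ _ (nbhs x)); [exact: coord_cvg | exact: cvg_cst].
have phiz : phi z = 0 by rewrite /phi /dot big1// => k _; rewrite !mxE subrr mulr0.
have vE x : barrier y z B x = phi x * (B * phi x - 1).
  have pE : phi x = \sum_k (x 0 k - y 0 k) * (x 0 k - z 0 k).
    by apply: eq_bigr => k _; rewrite !mxE.
  by rewrite /barrier -pE.
have : \forall x \near z, [/\ O x, B * phi x < 1 &
    0 < elliptic_op a b (barrier1 y z B) (barrier2 y z B) x].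
  near=> x; split.
  - by near: x; exact: open_nbhs_nbhs.
  - near: x.
    have /cvgr_lt : B * phi x @[x --> z] --> B * phi z.
      by apply: (@cvgMl_tmp _ _ (nbhs z)); exact: phi_cont.
    by apply; rewrite phiz mulr0.
  - near: x; exact: (cvgr_gt _ (elliptic_op_cont Oz ell c2v)).
move=> /nbhs_ballP[d' /= d'0 zd'].
pose d := d' / 2.
have d0 : 0 < d by rewrite divr_gt0.
have zd x : `|x - z| <= d -> [/\ O x, B * phi x < 1 &
    0 < elliptic_op a b (barrier1 y z B) (barrier2 y z B) x].
  move=> xd; apply: zd'; rewrite -ball_normE/= distrC (le_lt_trans xd)//.
  by rewrite /d ltr_pdivrMr// ltr_pMr// ltr1n.
pose K := [set x | `|x - z| <= d].
have cK : compact K by exact: closed_ball_compact.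
have ncont : continuous (fun x => `|x - z|).
  move=> x; apply: (@cvg_norm _ _ _ (nbhs x)).
  by apply: (@cvgB _ _ _ (nbhs x)); [exact: cvg_id | exact: cvg_cst].
(* The part of the boundary of the cube lying in the ball: there the barrier is not negative, but
   [u] is below M by a uniform amount. *)
pose E := K `&` ((fun x => `|x - z|) @^-1` [set t | d <= t]
             `&` phi @^-1` [set t | t <= 0]).
have cE : compact E.
  apply: compact_closedI => //; apply: closedI; apply: preimage_closed.
  - by move=> x _; exact: ncont.
  - exact: closed_ge.
  - by move=> x _; exact: phi_cont.
  - exact: closed_le.
have contK (w : 'rV[R]_m -> R) W1 W2 (A : set 'rV[R]_m) : A `<=` K ->
    C2_with O w W1 W2 -> {within A, continuous w}.
  move=> AK c2; apply: continuous_in_subspaceT => x /set_mem /AK/zd[Ox _ _].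
  exact/differentiable_continuous/(C2_with_differentiable oO Ox c2).1.
have EK : E `<=` K by move=> x [].
have [c c0 cP] : exists2 c, 0 < c &
    forall x, E x -> u x + c * barrier y z B x < M.
  apply: perturbation_lt => //; [exact: contK c2u | exact: contK c2v | ].
  move=> x [Kx /= [dx phix]]; have [Ox _ _] := zd x Kx.
  apply: touch => //; apply/eqP => xz; move: dx.
  by rewrite xz subrr normr0 leNgt d0.
pose w := u + c *: barrier y z B.
have wE x : w x = u x + c * barrier y z B x by [].
have c2w := C2_with_comb c c2u c2v.
have wz : w z = M by rewrite wE barrier_eq0 mulr0 addr0.
have K0 : K !=set0 by exists z; rewrite /K/= subrr normr0 ltW.
have [s /set_mem Ks sP] := compact_EVT_max K0 cK (contK _ _ _ _ (@subset_refl _ K) c2w).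
have wsM : M <= w s by rewrite -wz; apply/sP/mem_set; rewrite /K/= subrr normr0 ltW.
(* On the boundary of the cube, phi <= 0 is covered by the choice of [c], and for 0 < phi < 1/B the
   barrier is negative. *)
have sd : `|s - z| < d.
  rewrite ltNge; apply/negP => ds; have [Os Bs _] := zd s Ks.
  have [phis|phis] := leP (phi s) 0.
    by have := cP s (conj Ks (conj ds phis)); rewrite -wE ltNge wsM.
  suff : w s < M by rewrite ltNge wsM.
  rewrite wE -[M]addr0; apply: ler_ltD; first exact: uM.
  by rewrite vE pmulr_rlt0// pmulr_rlt0// subr_lt0.
pose U := [set x | `|x - z| < d].
have oU : open U.
  have -> : U = (fun x => `|x - z|) @^-1` [set t : R | t < d] by [].
  by apply: open_comp; [move=> x _; exact: ncont | exact: open_lt].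
have UO x : U x -> O x by move=> /ltW/zd[].
have := @elliptic_op_max U a b w _ _ s oU sd (fun x Ux => ell x (UO x Ux))
  (fun x Ux => c2w x (UO x Ux)) (fun x Ux => sP x (mem_set (ltW Ux))).
have [Os _ Ls] := zd s Ks.
by rewrite elliptic_op_comb (Lu s Os) add0r leNgt mulr_gt0.
Unshelve. all: by end_near. Qed.

End Hopf.

Section StrongMax.
Context {R : realType} {m : nat}.
Implicit Types (O : set 'rV[R]_m) (u : 'rV[R]_m -> R) (x y z : 'rV[R]_m).

Lemma dot_ge0 x : 0 <= dot x x.
Proof. by apply: sumr_ge0 => k _; rewrite -expr2 sqr_ge0. Qed.

(** The norm on rows is the sup norm, whereas nearest points below are taken for the Euclidean
    distance; this passes from the latter to the former. *)
Lemma le_norm_dot x (r : R) : 0 < r -> dot x x < r ^+ 2 -> `|x| < r.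
Proof.
move=> r0 xr; rewrite [ltLHS]/Num.Def.normr/= mx_normrE.
apply: bigmax_lt => // -[i j] _ /=; rewrite ord1.
rewrite -(@ltr_pXn2r _ 2)// ?nnegrE ?ltW// real_normK ?num_real//.
apply: le_lt_trans xr; rewrite /dot (bigD1 j)//= -expr2 lerDl.
by apply: sumr_ge0 => k _; rewrite -expr2 sqr_ge0.
Qed.

Lemma dot_gt0 x : x != 0 -> 0 < dot x x.
Proof.
rewrite lt_def dot_ge0 andbT; apply: contra_neq => x0.
apply/rowP => j; apply/eqP; rewrite mxE -sqrf_eq0 eq_le sqr_ge0 andbT -[leRHS]x0.
rewrite /dot (bigD1 j)//= -expr2 lerDl.
by apply: sumr_ge0 => k _; rewrite -expr2 sqr_ge0.
Qed.

(** The law of cosines. When [dot (x - y) (x - z) <= 0] and x differs from z, it makes x strictly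
    closer to y than z is. *)
Lemma dot_three_points x y z :
  dot (z - y) (z - y) = dot (z - x) (z - x) + dot (x - y) (x - y)
    - 2 * dot (x - y) (x - z).
Proof.
rewrite /dot mulr_sumr -big_split -sumrB; apply: eq_bigr => k _ /=.
by rewrite !mxE; ring.
Qed.

Lemma dot_sub_cont y : continuous (fun x => dot (x - y) (x - y)).
Proof.
move=> x; apply: (@cvg_sumr _ _ _ (nbhs x)) => k _; rewrite !mxE.
have -> : (fun t : 'rV[R]_m => (t - y) 0 k * (t - y) 0 k) =
    (fun t : 'rV[R]_m => t 0 k - y 0 k) \* (fun t => t 0 k - y 0 k).
  by apply/funext => t; rewrite /= !mxE.
by apply: (@cvgM _ _ (nbhs x));
  apply: (@cvgB _ _ _ (nbhs x)); [exact: coord_cvg|exact: cvg_cst|exact: coord_cvg|exact: cvg_cst].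
Qed.

(** If [u y] is below the maximum for some y near x0, let z be a point of the maximum set nearest to
    y. The ball with diameter [y, z] lies inside the ball about y through z and meets its sphere
    only at z, so it meets the maximum set only at z. This is the configuration excluded by
    [no_interior_touch]. *)
Theorem strong_max_principle O a b u U1 U2 x0 : open O -> O x0 ->
  elliptic_coeffs O a b -> C2_with O u U1 U2 ->
  (forall x, O x -> elliptic_op a b U1 U2 x = 0) ->
  (forall x, O x -> u x <= u x0) -> \forall x \near x0, u x = u x0.
Proof.
move=> oO Ox0 ell c2u Lu uM.
have [r /= r0 x0r] : nbhs_ball x0 O.
  exact/nbhs_ballP/open_nbhs_nbhs.
pose rho := r / 2.
have rho0 : 0 < rho by rewrite divr_gt0.
pose K := [set x | `|x - x0| <= rho].
have KO : K `<=` O.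
  move=> x xK; apply: x0r; rewrite -ball_normE/= distrC (le_lt_trans xK)//.
  by rewrite /rho ltr_pdivrMr// ltr_pMr// ltr1n.
have ucont x : K x -> {for x, continuous u}.
  move=> /KO Ox.
  exact/differentiable_continuous/(C2_with_differentiable oO Ox c2u).1.
have cK : compact K by exact: closed_ball_compact.
pose D := K `&` [set x | u x = u x0].
have cD : compact D.
  apply: (subclosed_compact _ cK) => [p clDp|x []//].
  have Kp : K p.
    have /closure_id -> : closed K by apply: compact_closed => //; exact: norm_hausdorff.
    by apply: closure_subset clDp => x [].
  split=> //=; apply/eqP; apply: contrapT => /negP up.
  have : \forall x \near p, u x != u x0.
    have /(_ [set t | t != u x0]) := ucont p Kp; apply.
    by apply: open_nbhs_nbhs; split => //; exact: open_neq.
  by move=> /clDp[x [[_ /= ->]]]; rewrite eqxx.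
have D0 : D !=set0 by exists x0; split=> //; rewrite /K/= subrr normr0 ltW.
near=> y; apply: contrapT => uy.
(* With this margin, every point at least as close to y as x0 is within [rho] of x0, hence in
   [K]. *)
have yx0 : dot (x0 - y) (x0 - y) < (rho / 2) ^+ 2.
  have -> : dot (x0 - y) (x0 - y) = dot (y - x0) (y - x0).
    by apply: eq_bigr => k _; rewrite !mxE; ring.
  near: y; apply: (cvgr_lt _ (@dot_sub_cont x0 x0)).
  by rewrite /dot big1 ?exprn_gt0 ?divr_gt0// => k _; rewrite !mxE subrr mulr0.
have [|z /set_mem[Kz uz] zP] := @compact_EVT_min _ _ (fun x => dot (x - y) (x - y)) D D0 cD.
  by apply: continuous_subspaceT; exact: dot_sub_cont.
have zx0 : dot (z - y) (z - y) <= dot (x0 - y) (x0 - y).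
  by apply/zP/mem_set; split=> //; rewrite /K/= subrr normr0 ltW.
apply: (@no_interior_touch _ _ O a b u U1 U2 (u x0) y z) => //.
- exact: KO.
- by apply/eqP => yz; apply: uy; rewrite yz.
move=> x Ox xz phix; rewrite lt_neqAle uM// andbT; apply/eqP => ux.
have q0 : 0 < dot (z - x) (z - x) by apply: dot_gt0; rewrite subr_eq0 eq_sym.
have qlt : dot (x - y) (x - y) < dot (z - y) (z - y).
  by rewrite (dot_three_points x y z); move: phix q0; lra.
(* Hence x is a point of [D] closer to y than z, a contradiction. *)
have Kx : K x.
  rewrite /K/= -(subrK y x) -addrA; apply: le_trans (ler_normD _ _) _.
  rewrite [leRHS]splitr lerD//; apply/ltW/le_norm_dot; rewrite ?divr_gt0//.
    exact: lt_trans qlt (le_lt_trans zx0 yx0).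
  suff -> : dot (y - x0) (y - x0) = dot (x0 - y) (x0 - y) by [].
  by apply: eq_bigr => k _; rewrite !mxE; ring.
by have := zP x (mem_set (conj Kx ux)); rewrite leNgt qlt.
Unshelve. all: by end_near. Qed.

End StrongMax.

(** * Smooth functions on subsets and partial derivatives *)

Section Cr.
Context {R : realType} {n : nat}.
Implicit Types (A O Q : set 'rV[R]_n) (f F : 'rV[R]_n -> R) (x : 'rV[R]_n).
Local Notation e := (@basis_vec R n).

Lemma Cr_local r O f : open O ->
  (forall x, O x -> exists Q F,
     [/\ open Q, Q x, Cr r Q F & forall y, O y -> Q y -> F y = f y]) ->
  Cr r O f.
Proof.
move=> oO; elim: r f => [|r IH] f loc.
  split=> // x Ox; have [Q [F [oQ Qx [cF _] Ff]]] := loc x Ox.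
  apply: near_eq_continuous (cF x Qx).
  have := open_nbhs_nbhs (conj (openI oO oQ) (conj Ox Qx)).
  by apply: filterS => y [Oy Qy]; exact: Ff.
split=> [x Ox|i].
  have [Q [F [oQ Qx [cF _] Ff]]] := loc x Ox.
  apply: near_eq_continuous (cF x Qx).
  have := open_nbhs_nbhs (conj (openI oO oQ) (conj Ox Qx)).
  by apply: filterS => y [Oy Qy]; exact: Ff.
split=> [x Ox|].
  have [Q [F [oQ Qx [_ /(_ i)[dF _]] Ff]]] := loc x Ox.
  apply: near_eq_derivable (dF x Qx).
  have := open_nbhs_nbhs (conj (openI oO oQ) (conj Ox Qx)).
  by apply: filterS => y [Oy Qy]; exact: Ff.
apply: IH => x Ox; have [Q [F [oQ Qx [_ /(_ i)[_ dF]] Ff]]] := loc x Ox.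
exists Q, ('D_(e i) F); split=> // y Oy Qy; apply: near_eq_derive.
have := open_nbhs_nbhs (conj (openI oO oQ) (conj Oy Qy)).
by apply: filterS => t [Ot Qt]; exact: Ff.
Qed.

(** On an open part of [A] the local extensions coincide with [f] itself, and being C^r is a local
    property. *)
Lemma smooth_on_open A O f r : smooth_on A f -> open O -> O `<=` A -> Cr r O f.
Proof.
move=> fA oO OA; apply: Cr_local => // x /OA/fA[Q [F [oQ Qx CF Ff]]].
by exists Q, F; split=> // y /OA Ay; exact: Ff.
Qed.

Lemma Cr_C2 O f : Cr 2 O f ->
  C2_with O f (fun i => 'D_(e i) f) (fun i j => 'D_(e j) ('D_(e i) f)).
Proof.
move=> [cf df] x Ox; split=> [i|i|i j|i j].
- by apply: derivableP; have [d _] := df i; exact: d.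
- by have [_ [c _]] := df i; exact: c.
- by apply: derivableP; have [_ [_ /(_ j)[d _]]] := df i; exact: d.
- by have [_ [_ /(_ j)[_ [c _]]]] := df i; exact: c.
Qed.

Lemma Cr1_differentiable O f x : open O -> O x -> Cr 1 O f -> differentiable f x.
Proof.
move=> oO Ox [cf df]; apply: differentiable_C1 => [|i]; last first.
  by have [_ [c _]] := df i; exact: c.
apply: filterS (open_nbhs_nbhs (conj oO Ox)) => y Oy i.
by have [d _] := df i; exact: d.
Qed.

(* Along a coordinate direction, the one-sided increments retained by [partial] *)
(* are then enough to compute the derivative of any extension of a function.   *)
Definition stable_steps A := forall x i, A x ->
  \forall t \near (0 : R)^'+, A (x + t *: e i).

(** Admissible positive steps make the filter in [partial] nontrivial, hence its limit unique. *)
Lemma steps_proper A x i : (\forall t \near (0 : R)^'+, A (x + t *: e i)) ->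
  ProperFilter (within [set t : R | A (x + t *: e i)] (0 : R)^').
Proof.
move=> stepA; split; last exact: within_filter.
rewrite /within/= => /nbhs_ballP[d /= d0 dA].
have : \forall t \near (0 : R)^'+, False; last exact: filter_not_empty.
near=> t; have t0 : 0 < t by [].
have td : t < d by near: t; exact: nbhs_right_lt.
have At : A (x + t *: e i) by near: t.
apply: (dA t) At; last by rewrite gt_eqF.
by rewrite -ball_normE/= sub0r normrN gtr0_norm.
Unshelve. all: by end_near. Qed.

(** The filter in [partial] refines the punctured neighbourhoods of 0, and along it the difference
    quotients of [f] and [F] eventually agree. *)
Lemma partial_extension A Q f F x i :
  (\forall t \near (0 : R)^'+, A (x + t *: e i)) -> A x -> open Q -> Q x ->
  (forall y, A y -> Q y -> F y = f y) -> derivable F x (e i) ->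
  partial A f x i = 'D_(e i) F x.
Proof.
move=> stepA Ax oQ Qx Ff dF.
have pF := steps_proper stepA.
apply: cvg_lim => //.
have dF' : h^-1 * (F (x + h *: e i) - F x) @[h --> (0 : R)^'] --> 'D_(e i) F x.
  have := dF; rewrite /derivable /derive.
  suff -> : (fun h : R => h^-1 *: ((F \o shift x) (h *: e i) - F x)) =
    (fun h => h^-1 * (F (x + h *: e i) - F x)) by [].
  by apply/funext => h; rewrite /= [_ *: _ + x]addrC.
have : h^-1 * (F (x + h *: e i) - F x)
    @[h --> within [set t : R | A (x + t *: e i)] (0 : R)^'] --> 'D_(e i) F x.
  apply: cvg_trans dF'; apply: cvg_app; exact: cvg_within.
apply: cvg_trans; apply: near_eq_cvg; rewrite near_withinE.
have xQ : \forall t \near (0 : R), Q (x + t *: e i).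
  have : (fun t : R => x + t *: e i) t @[t --> (0 : R)] --> x.
    rewrite -[X in _ --> X]addr0 -[X in _ + X](scale0r (e i)).
    by apply: cvgD; [exact: cvg_cst | exact: cvgZr_tmp].
  by apply; exact: open_nbhs_nbhs.
apply: cvg_within; apply: filterS xQ => t Qt At.
by rewrite !Ff.
Qed.

Lemma open_steps O : open O -> stable_steps O.
Proof.
move=> oO x i Ox; apply: cvg_within.
have : (fun t : R => x + t *: e i) t @[t --> (0 : R)] --> x.
  rewrite -[X in _ --> X]addr0 -[X in _ + X](scale0r (e i)).
  by apply: cvgD; [exact: cvg_cst | exact: cvgZr_tmp].
by apply; exact: open_nbhs_nbhs.
Qed.

Lemma partial_open A O f x i : open O -> O `<=` A -> O x ->
  derivable f x (e i) -> partial A f x i = 'D_(e i) f x.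
Proof.
move=> oO OA Ox df; apply: (@partial_extension A O) => //; last exact: OA.
by apply: filterS (open_steps oO i Ox) => t; exact: OA.
Qed.

End Cr.

(** * Continuity of matrix-valued maps *)

Definition mx_continuous_at (R : realType) (T : topologicalType) m n
    (M : T -> 'M[R]_(m, n)) (x : T) :=
  forall i j, {for x, continuous (fun t => M t i j)}.

Section MxContinuity.
Context {R : realType} {T : topologicalType} (x : T).

Lemma cont_prod (I : Type) (r : seq I) (P : pred I) (f : I -> T -> R) :
  (forall i, P i -> {for x, continuous (f i)}) ->
  {for x, continuous (fun t => \prod_(i <- r | P i) f i t)}.
Proof.
by move=> fa; apply: (@cvg_big _ _ _ _ _ _ _ (nbhs x)) => //; exact: mul_continuous.
Qed.

Lemma cont_sum (I : Type) (r : seq I) (P : pred I) (f : I -> T -> R) :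
  (forall i, P i -> {for x, continuous (f i)}) ->
  {for x, continuous (fun t => \sum_(i <- r | P i) f i t)}.
Proof. by move=> fa; exact: (@cvg_sumr _ _ _ (nbhs x)). Qed.

Lemma cont_mul (f g : T -> R) : {for x, continuous f} -> {for x, continuous g} ->
  {for x, continuous (fun t => f t * g t)}.
Proof. by move=> cf cg; exact: cvgM cf cg. Qed.

Lemma cont_add (f g : T -> R) : {for x, continuous f} -> {for x, continuous g} ->
  {for x, continuous (fun t => f t + g t)}.
Proof. by move=> cf cg; exact: cvgD cf cg. Qed.

Lemma cont_sub (f g : T -> R) : {for x, continuous f} -> {for x, continuous g} ->
  {for x, continuous (fun t => f t - g t)}.
Proof. by move=> cf cg; exact: cvgB cf cg. Qed.

Lemma cont_cst (c : R) : {for x, continuous (fun _ : T => c)}.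
Proof. exact: cvg_cst. Qed.

Lemma mulmx_cont m n p (A : T -> 'M[R]_(m, n)) (B : T -> 'M[R]_(n, p)) :
  mx_continuous_at A x -> mx_continuous_at B x ->
  mx_continuous_at (fun t => A t *m B t) x.
Proof.
move=> cA cB i j.
have -> : (fun t => (A t *m B t) i j) = fun t => \sum_k A t i k * B t k j.
  by apply/funext => t; rewrite mxE.
by apply: cont_sum => k _; exact: cont_mul.
Qed.

Lemma trmx_cont m n (A : T -> 'M[R]_(m, n)) :
  mx_continuous_at A x -> mx_continuous_at (fun t => (A t)^T) x.
Proof.
move=> cA i j; have -> : (fun t => (A t)^T i j) = fun t => A t j i; last exact: cA.
by apply/funext => t; rewrite mxE.
Qed.

Lemma det_cont n (A : T -> 'M[R]_n) :
  mx_continuous_at A x -> {for x, continuous (fun t => \det (A t))}.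
Proof.
move=> cA; apply: cont_sum => s _; apply: cont_mul; first exact: cont_cst.
by apply: cont_prod => i _; exact: cA.
Qed.

Lemma invmx_cont n (A : T -> 'M[R]_n) : A x \in unitmx ->
  mx_continuous_at A x -> mx_continuous_at (fun t => invmx (A t)) x.
Proof.
move=> Ax cA i j.
have detx : \det (A x) != 0 by rewrite -unitfE -unitmxE.
(* [invmx] is the adjugate over the determinant only at invertible matrices, so the formula is used
   near [x]. *)
have dnear : \forall t \near x, \det (A t) != 0.
  have /(_ [set s | s != 0]) := det_cont cA; apply.
  by apply: open_nbhs_nbhs; split => //; exact: open_neq.
apply: (@near_eq_continuous _ _ (fun t => (\det (A t))^-1 * (\adj (A t)) i j)).
  apply: filterS dnear => t dt.
  by rewrite /invmx unitmxE unitfE dt [RHS]mxE.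
apply: cont_mul; first by apply: cvgV => //; exact: det_cont.
have -> : (fun t => (\adj (A t)) i j) =
    fun t => (-1) ^+ (j + i) * \det (row' j (col' i (A t))).
  by apply/funext => t; rewrite mxE.
apply: cont_mul; first exact: cont_cst.
apply: det_cont => k l.
have -> : (fun t => (row' j (col' i (A t))) k l) = fun t => A t (lift j k) (lift i l).
  by apply/funext => t; rewrite !mxE.
exact: cA.
Qed.

End MxContinuity.

Lemma rV_cont (R : realType) (T : topologicalType) n (f : T -> 'rV[R]_n) x :
  (forall j, {for x, continuous (fun t => f t 0 j)}) -> {for x, continuous f}.
Proof.
move=> cf; apply/cvgrPdist_le => e e0.
near=> t; apply: mx_norm_le => [|i j]; first exact: ltW.
rewrite ord1 !mxE; move: j; near: t; apply: filter_forall => j.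
by move/cvgrPdist_le : (cf j); exact.
Unshelve. all: by end_near. Qed.

(** * Functions on a product that depend on the first factor only *)

Section ProductDomain.
Context {R : realType} {n k : nat}.
Local Notation lsub := (@lsubmx R 1 n k).
Implicit Types (A O : set 'rV[R]_n) (f : 'rV[R]_n -> R) (x : 'rV[R]_(n + k)).

Lemma lsubmx_basis_l i : lsub (basis_vec R (lshift k i)) = basis_vec R i :> 'rV_n.
Proof. by apply/rowP => j; rewrite !mxE (inj_eq (@lshift_inj _ _)). Qed.

Lemma lsubmx_basis_r i : lsub (basis_vec R (rshift n i)) = 0 :> 'rV_n.
Proof. by apply/rowP => j; rewrite !mxE eq_lrshift. Qed.

Lemma lsub_step (t : R) v x : lsub (t *: v + x) = t *: lsub v + lsub x.
Proof. by rewrite linearD linearZ. Qed.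

Lemma stable_steps_prod A : stable_steps A ->
  stable_steps [set x : 'rV[R]_(n + k) | A (lsub x)].
Proof.
move=> stA x i Ax; rewrite -(splitK i); case: (fintype.split i) => j /=.
  have := stA (lsub x) j Ax; apply: filterS => t.
  by rewrite /= linearD linearZ/= lsubmx_basis_l.
by near=> t; rewrite /= linearD linearZ/= lsubmx_basis_r scaler0 addr0.
Unshelve. all: by end_near. Qed.

Lemma derive_lsubmx_l f i :
  'D_(basis_vec R (lshift k i)) (f \o lsub) = 'D_(basis_vec R i) f \o lsub.
Proof.
apply/funext => x; rewrite /derive/=.
set F1 := (X in lim (X @ _) = _); set F2 := (X in _ = lim (X @ _)).
suff -> : F1 = F2 by [].
by apply/funext => h; rewrite /F1 /F2 /= lsub_step lsubmx_basis_l.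
Qed.

Lemma derivable_lsubmx_l f i x : derivable f (lsub x) (basis_vec R i) ->
  derivable (f \o lsub) x (basis_vec R (lshift k i)).
Proof.
rewrite /derivable; set F1 := (X in cvg (X @ _)); set F2 := (X in _ -> cvg (X @ _)).
suff -> : F1 = F2 by [].
by apply/funext => h; rewrite /F1 /F2 /= lsub_step lsubmx_basis_l.
Qed.

Lemma is_derive_lsubmx_r f i x :
  is_derive x (basis_vec R (rshift n i)) (f \o lsub) 0.
Proof.
have E : (fun h : R => h^-1 *: (((f \o lsub) \o shift x) (h *: basis_vec R (rshift n i))
   - (f \o lsub) x)) = fun _ => 0.
  apply/funext => h.
  by rewrite /= lsub_step lsubmx_basis_r scaler0 add0r subrr scaler0.
apply: DeriveDef; rewrite /derivable /derive E; first exact: is_cvg_cst.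
by apply: cvg_lim => //; exact: cvg_cst.
Qed.

Lemma Cr_cst p r (O : set 'rV[R]_p) (c : R) : Cr r O (fun _ => c).
Proof.
elim: r c => [|r IH] c; first by split=> // x _; exact: cont_cst.
split=> [x _|i]; first exact: cont_cst.
split=> [x _|]; first exact: derivable_cst.
have -> : 'D_(basis_vec R i) (fun _ : 'rV[R]_p => c) = fun _ => 0.
  by apply/funext => x; rewrite derive_cst.
exact: IH.
Qed.

Lemma Cr_prod r O f : Cr r O f -> Cr r [set x : 'rV[R]_(n + k) | O (lsub x)] (f \o lsub).
Proof.
have cont g (x : 'rV[R]_(n + k)) : {for lsub x, continuous g} ->
    {for x, continuous (g \o lsub : _ -> R)}.
  by move=> cg; exact: (@continuous_comp _ _ _ lsub g x (@continuous_lsubmx R 1 n k x) cg).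
elim: r f => [|r IH] f; first by move=> [cf _]; split=> // x Ox; exact/cont/cf.
move=> [cf df]; split=> [x Ox|i]; first exact/cont/cf.
rewrite -(splitK i); case: (fintype.split i) => j /=.
  have [dj Dj] := df j; split=> [x Ox|]; first exact/derivable_lsubmx_l/dj.
  by rewrite derive_lsubmx_l; exact: IH.
split=> [x Ox|]; first by have [] := is_derive_lsubmx_r f j x.
have -> : 'D_(basis_vec R (rshift n j)) (f \o lsub) = fun _ => 0.
  by apply/funext => x; have [] := is_derive_lsubmx_r f j x.
exact: Cr_cst.
Qed.

Lemma smooth_on_cst p (A : set 'rV[R]_p) (c : R) : smooth_on A (fun _ => c).
Proof.
move=> x Ax; exists setT, (fun _ => c); split=> //; first exact: openT.
by move=> r; exact: Cr_cst.
Qed.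

Lemma smooth_on_prod A f : smooth_on A f ->
  smooth_on [set x : 'rV[R]_(n + k) | A (lsub x)] (f \o lsub).
Proof.
move=> fA x /fA[Q [F [oQ Qx CF Ff]]].
exists [set x | Q (lsub x)], (F \o lsub); split=> //.
- by apply: open_comp => // y _; exact: continuous_lsubmx.
- by move=> r; exact: Cr_prod.
- by move=> y; exact: Ff.
Qed.

End ProductDomain.

Lemma partial_cst (R : realType) n (A : set 'rV[R]_n) (c : R) x i :
  stable_steps A -> A x -> partial A (fun _ => c) x i = 0.
Proof.
move=> stA Ax; rewrite (@partial_extension _ _ _ setT _ (fun _ => c))//.
- by rewrite derive_cst.
- exact: stA.
- exact: openT.
Qed.

Lemma partial_prod_r (R : realType) n k (A : set 'rV[R]_n) f (x : 'rV[R]_(n + k)) i :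
  stable_steps A -> A (lsubmx x) ->
  partial [set x : 'rV[R]_(n + k) | A (lsubmx x)] (f \o lsubmx) x (rshift n i) = 0.
Proof.
move=> stA Ax; have [dfx Dfx] := is_derive_lsubmx_r f i x.
rewrite (@partial_extension _ _ _ setT _ (f \o lsubmx))//.
- exact: (stable_steps_prod stA).
- exact: openT.
Qed.

Section SmoothComp.
Context {R : realType} {m d : nat}.
Variables (A : set 'rV[R]_d) (O : set 'rV[R]_m) (Phi : 'rV[R]_m -> 'rV[R]_d).
Hypotheses (stA : stable_steps A) (oO : open O) (PhiA : forall x, O x -> A (Phi x)).
Hypothesis PhiC : forall j, Cr 1 O (fun x => Phi x 0 j).

(** [Phi] may run along the boundary of [A]. The chain rule is applied to a local extension of [f],
    whose derivatives are then rewritten as [partial A f], the form in which derivatives of the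
    metric enter the Christoffel symbols. *)
Lemma smooth_comp f x : smooth_on A f -> O x ->
  (forall i, is_derive x (basis_vec R i) (f \o Phi)
     (\sum_r 'D_(basis_vec R i) (fun x => Phi x 0 r) x * partial A f (Phi x) r)) /\
  {for x, continuous (f \o Phi)} /\
  (forall r, {for x, continuous (fun t => partial A f (Phi t) r)}).
Proof.
move=> fA Ox; have [Q [F [oQ Qx CF Ff]]] := fA _ (PhiA Ox).
have cPhi : {for x, continuous Phi}.
  by apply: rV_cont => j; have [c _] := PhiC j; exact: c.
have near_x : \forall t \near x, O t /\ Q (Phi t).
  near=> t; split; first by near: t; exact: open_nbhs_nbhs.
  by near: t; apply: cPhi; exact: open_nbhs_nbhs.
have dF y r : Q y -> derivable F y (basis_vec R r).
  by move=> Qy; have [_ /(_ r)[dr _]] := CF 1%N; exact: dr.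
have pE y r : A y -> Q y -> partial A f y r = 'D_(basis_vec R r) F y.
  by move=> Ay Qy; apply: (partial_extension (stA r Ay) Ay oQ Qy Ff); exact: dF.
split=> [i|].
  apply: (@near_eq_is_derive _ _ _ (F \o Phi)).
    by apply: filterS near_x => t [Ot Qt]; exact: Ff (PhiA Ot) Qt.
  apply: is_derive_eq (is_derive_comp _ _) _.
  - exact: Cr1_differentiable oQ Qx (CF 1%N).
  - by move=> j; have [_ /(_ i)[dj _]] := PhiC j; exact: dj.
  - by apply: eq_bigr => r _; rewrite pE//; exact: PhiA.
split=> [|r].
  apply: (@near_eq_continuous _ _ (F \o Phi)).
    by apply: filterS near_x => t [Ot Qt]; exact: Ff (PhiA Ot) Qt.
  by apply: continuous_comp => //; have [c _] := CF 0%N; exact: c.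
apply: (@near_eq_continuous _ _ ('D_(basis_vec R r) F \o Phi)).
  by apply: filterS near_x => t [Ot Qt] /=; rewrite pE//; exact: PhiA.
apply: continuous_comp => //.
by have [_ /(_ r)[_ [c _]]] := CF 1%N; exact: c.
Unshelve. all: by end_near. Qed.

End SmoothComp.

(** * The minimal hypersurface equation at a point *)

Section PosDef.
Context {R : realType}.

Definition posdef n (P : 'M[R]_n) := P^T = P /\ forall v, v != 0 -> 0 < inner P v v.

Lemma posdef_unit n (P : 'M[R]_n) : posdef P -> P \in unitmx.
Proof.
move=> [_ Ppos]; rewrite -row_free_unit -kermx_eq0; apply/rowV0P => v /sub_kermxP vP.
apply/eqP; apply: contraT => /Ppos.
by rewrite /inner vP mul0mx mxE ltxx.
Qed.

Lemma posdef_congr m n (P : 'M[R]_n) (T : 'M[R]_(m, n)) : posdef P -> row_free T ->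
  posdef (T *m P *m T^T).
Proof.
move=> [Psym Ppos] Tfree; split; first by rewrite !trmx_mul trmxK Psym mulmxA.
move=> v v0; have := Ppos (v *m T); rewrite mulmx_free_eq0// => /(_ v0).
by rewrite /inner trmx_mul !mulmxA.
Qed.

Lemma posdef_inv n (P : 'M[R]_n) : posdef P -> posdef (invmx P).
Proof.
move=> posP; have [Psym Ppos] := posP; have Pu := posdef_unit posP.
have invsym : (invmx P)^T = invmx P by rewrite trmx_inv Psym.
split=> // v v0; have := Ppos (v *m invmx P).
rewrite mulmx_free_eq0 ?row_free_unit ?unitmx_inv// => /(_ v0).
by rewrite /inner mulmxKV// trmx_mul invsym mulmxA.
Qed.

End PosDef.

Section NormalForm.
Context {R : realType} {m d : nat}.
Variables (T : 'M[R]_(m, d)) (G : 'M[R]_d) (dG : 'I_d -> 'I_d -> 'I_d -> R).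
Variables (H : 'I_m -> 'I_m -> 'I_d -> R) (N : 'rV[R]_d) (dN : 'I_m -> 'I_d -> R).
Variable (dpsi : 'rV[R]_d).

(* With dG r symmetric this is the Christoffel symbol of the first kind         *)
(* (dG a b p + dG p b a - dG b a p) / 2; in this form symmetry is not needed.   *)
Definition lowered_christoffel (b a p : 'I_d) : R :=
  dG a p b - 2^-1 * (dG a b p + dG b a p - dG p a b).

Definition lowered_trace (b : 'I_d) : R :=
  \sum_j \sum_i invmx (T *m G *m T^T) j i *
    (\sum_p H i j p * G p b +
     \sum_a \sum_p lowered_christoffel b a p * T i a * T j p).

Hypotheses (md : m.+1 = d) (posG : posdef G) (Tfree : row_free T).
Hypotheses (TN : T *m G *m N^T = 0) (NN : inner G N N = 1).
Hypothesis (dTN : forall i j, \sum_p \sum_b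
   (H i j p * G p b * N 0 b + T j p * (\sum_a T i a * dG a p b) * N 0 b
    + T j p * G p b * dN i b) = 0).

Let chr l a b := 2^-1 * \sum_r invmx G l r * (dG a b r + dG b a r - dG r a b).
Let cov : 'M[R]_(m, d) :=
  \matrix_(i, l) (dN i l + \sum_a \sum_b chr l a b * T i a * N 0 b).

Hypothesis minimal :
  - \tr (invmx (T *m G *m T^T) *m (cov *m G *m T^T))
  - inner G (dpsi *m invmx G) N = 0.

Let chr_lower a b p : \sum_l chr l a b * G l p =
  2^-1 * (dG a b p + dG b a p - dG p a b).
Proof.
have [Gsym _] := posG; have Gu := posdef_unit posG.
rewrite /chr; under eq_bigr do rewrite -mulrA mulr_suml.
rewrite -mulr_sumr exchange_big; congr (_ * _) => /=.
have E r l : invmx G l r * (dG a b r + dG b a r - dG r a b) * G l p =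
  (dG a b r + dG b a r - dG r a b) * (invmx G r l * G l p).
  have -> : invmx G l r = invmx G r l by have [/matrixP/(_ r l) + _] := posdef_inv posG; rewrite mxE.
  by ring.
under eq_bigr => r _ do [under eq_bigr => l _ do rewrite E; rewrite -mulr_sumr].
have D r : \sum_l invmx G r l * G l p = (r == p)%:R.
  by have := mulVmx Gu => /matrixP/(_ r p); rewrite !mxE.
rewrite (bigD1 p)//= D eqxx mulr1 big1 ?addr0// => r rp.
by rewrite D (negbTE rp) mulr0.
Qed.

(** Weingarten's relation <D_i N, d_j F> = - <D_i d_j F, N>, from the derivative [dTN] of the
    orthogonality relation. *)
Let cov_tangent i j : (cov *m G *m T^T) i j =
  - \sum_b (\sum_p H i j p * G p b +
     \sum_a \sum_p lowered_christoffel b a p * T i a * T j p) * N 0 b.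
Proof.
have [Gsym _] := posG.
apply/eqP; rewrite -addr_eq0; apply/eqP; rewrite -[RHS](dTN i j).
have -> : (cov *m G *m T^T) i j =
    \sum_p \sum_b (T j p * G p b * dN i b +
      \sum_a 2^-1 * (dG a b p + dG b a p - dG p a b) * T i a * N 0 b * T j p).
  rewrite mxE; apply: eq_bigr => p _; rewrite big_split/= mxE [T^T _ _]mxE.
  have -> : \sum_l cov i l * G l p = \sum_l dN i l * G l p +
      \sum_l \sum_a \sum_b chr l a b * T i a * N 0 b * G l p.
    rewrite -big_split; apply: eq_bigr => l _ /=; rewrite mxE mulrDl mulr_suml.
    by congr (_ + _); apply: eq_bigr => a _; rewrite mulr_suml.
  rewrite mulrDl mulr_suml; congr (_ + _).
    apply: eq_bigr => l _; rewrite -[in G p l]Gsym mxE; ring.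
  rewrite exchange_big mulr_suml [in RHS]exchange_big/=; apply: eq_bigr => a _.
  rewrite exchange_big mulr_suml; apply: eq_bigr => b _ /=.
  rewrite -chr_lower !mulr_suml; apply: eq_bigr => l _; ring.
have -> : \sum_b (\sum_p H i j p * G p b +
     \sum_a \sum_p lowered_christoffel b a p * T i a * T j p) * N 0 b =
  \sum_p \sum_b (H i j p * G p b * N 0 b +
     \sum_a lowered_christoffel b a p * T i a * T j p * N 0 b).
  rewrite [RHS]exchange_big; apply: eq_bigr => b _ /=.
  rewrite mulrDl big_split/= !mulr_suml; congr (_ + _).
  rewrite [RHS]exchange_big; apply: eq_bigr => a _ /=.
  by rewrite mulr_suml.
rewrite -big_split; apply: eq_bigr => p _ /=.
rewrite -big_split; apply: eq_bigr => b _ /=.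
rewrite addrACA [X in X + _ = _]addrC -big_split/= -addrA.
rewrite [RHS]addrAC -addrA; congr (_ + (_ + _)).
rewrite mulr_sumr mulr_suml; apply: eq_bigr => a _ /=.
by rewrite /lowered_christoffel; ring.
Qed.

Let lowered : 'rV[R]_d := \row_b (lowered_trace b - dpsi 0 b).

(** By Weingarten's relation the pairing of [lowered] with [N] is exactly H_psi. *)
Let lowered_normal : lowered *m N^T = 0.
Proof.
have Gu := posdef_unit posG.
apply/matrixP => i0 j0; rewrite !ord1 [RHS]mxE -[RHS]minimal; rewrite /inner mulmxKV//.
rewrite /mxtrace !mxE -sumrN.
under eq_bigr => b _ do rewrite mxE [N^T _ _]mxE mulrBl.
rewrite sumrB; congr (_ - _); last by apply: eq_bigr => b _; rewrite [N^T _ _]mxE.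
under [RHS]eq_bigr => j _ do rewrite mxE -sumrN.
rewrite /lowered_trace.
under [LHS]eq_bigr => b _ do rewrite mulr_suml.
rewrite exchange_big; apply: eq_bigr => j _ /=.
under [LHS]eq_bigr => b _ do rewrite mulr_suml.
rewrite exchange_big; apply: eq_bigr => i _ /=.
rewrite cov_tangent mulrN opprK mulr_sumr; apply: eq_bigr => b _.
by rewrite mulrA.
Qed.

(* The covectors vanishing on N form a space of dimension m, which is therefore  *)
(* the row space of T *m G.                                                      *)
Lemma lowered_trace_tangent b :
  lowered_trace b - dpsi 0 b =
  (lowered *m T^T *m invmx (T *m G *m T^T) *m (T *m G)) 0 b.
Proof.
have Gu := posdef_unit posG.
have N0 : N != 0.
  apply: contra_eq_neq NN => N0; rewrite /inner N0 !mul0mx mxE.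
  by rewrite eq_sym oner_neq0.
have rN : \rank N^T = 1%N by rewrite mxrank_tr rank_rV N0.
have TG_ker : (T *m G <= kermx N^T)%MS by apply/sub_kermxP.
have rTG : \rank (T *m G) = m.
  by rewrite mxrankMfree ?row_free_unit//; apply/eqP.
have : (lowered <= T *m G)%MS.
  have /sub_kermxP low_ker := lowered_normal.
  apply: submx_trans low_ker _.
  rewrite -(geq_leqif (mxrank_leqif_sup TG_ker)).
  by rewrite mxrank_ker rN rTG -md subn1.
move=> /submxP[beta0 lowE].
have PU := posdef_unit (posdef_congr posG Tfree).
have -> : lowered_trace b - dpsi 0 b = lowered 0 b by rewrite mxE.
(* Multiplying [lowered = beta0 *m (T *m G)] by [T^T] and inverting the induced metric recovers
   [beta0]. *)
by rewrite [in RHS]lowE -[beta0 *m _ *m T^T]mulmxA mulmxK// -lowE.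
Qed.

End NormalForm.

(** * Minimal hypersurfaces of the product *)

Section ProductChart.
Context {R : realType} {T : topologicalType} {n k : nat} (A : atlas R T n).
Hypothesis mfdA : smooth_manifold A.

Lemma chart_image_prod (c : chart A) :
  chart_image (c : chart (prod_atlas k A)) =
  [set x : 'rV[R]_(n + k) | chart_image c (lsubmx x)].
Proof.
apply/seteqP; split=> x.
  by move=> [[p t] /= [cp _] <-]; rewrite /= row_mxKl; exists p.
move=> [p cp px]; exists (p, rsubmx x) => //=.
by rewrite px hsubmxK.
Qed.

(** This is why [stable_steps] looks at positive increments: no coordinate direction leaves the
    half-space that way. *)
Lemma half_space_steps (x : 'rV[R]_n) i (t : R) : 0 <= t ->
  half_space x -> half_space (x + t *: basis_vec R i).
Proof.
move=> t0 [j [j0 xj]]; exists j; split=> //.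
by rewrite !mxE addr_ge0// mulr_ge0//; case: ifP.
Qed.

Lemma chart_image_steps (c : chart A) : stable_steps (chart_image c).
Proof.
have [_ _ _ /(_ c)[_ _ [Q oQ ->] _ _] _] := mfdA.
move=> x i [Qx mx]; near=> t; split; first by near: t; exact: open_steps.
move: mx; rewrite /model; case: (bdry c) => //; apply: half_space_steps.
by apply: ltW.
Unshelve. all: by end_near. Qed.

Lemma chart_image_prod_steps (c : chart A) :
  stable_steps (chart_image (c : chart (prod_atlas k A))).
Proof. by rewrite chart_image_prod; apply/stable_steps_prod/chart_image_steps. Qed.

Variable g : metric A.
Hypothesis riemg : riemannian g.

Lemma prod_metric_lr (c : chart A) i j :
  (fun x => prod_metric k g c x (lshift k i) (rshift n j)) = fun _ => 0.
Proof. by apply/funext => x; rewrite /prod_metric block_mxEur mxE. Qed.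

Lemma prod_metric_rl (c : chart A) i j :
  (fun x => prod_metric k g c x (rshift n i) (lshift k j)) = fun _ => 0.
Proof. by apply/funext => x; rewrite /prod_metric block_mxEdl mxE. Qed.

Lemma prod_metric_rr (c : chart A) i j :
  (fun x => prod_metric k g c x (rshift n i) (rshift n j)) = fun _ => (i == j)%:R.
Proof. by apply/funext => x; rewrite /prod_metric block_mxEdr mxE. Qed.

Lemma prod_metric_ll (c : chart A) i j :
  (fun x => prod_metric k g c x (lshift k i) (lshift k j)) =
  (fun x => g c x i j) \o lsubmx.
Proof. by apply/funext => x; rewrite /prod_metric block_mxEul. Qed.

Lemma prod_metric_smooth (c : chart A) a b :
  smooth_on (chart_image (c : chart (prod_atlas k A)))
    (fun x => prod_metric k g c x a b).
Proof.
have [gs _ _ _] := riemg; rewrite chart_image_prod.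
rewrite -(splitK a) -(splitK b).
case: (fintype.split a) => i; case: (fintype.split b) => j /=.
- by rewrite prod_metric_ll; exact: smooth_on_prod.
- by rewrite prod_metric_lr; exact: smooth_on_cst.
- by rewrite prod_metric_rl; exact: smooth_on_cst.
- by rewrite prod_metric_rr; exact: smooth_on_cst.
Qed.

Lemma prod_metric_posdef (c : chart A) x :
  chart_image (c : chart (prod_atlas k A)) x -> posdef (prod_metric k g c x).
Proof.
rewrite chart_image_prod => cx; have [_ gsym gpos _] := riemg.
split; first by rewrite /prod_metric tr_block_mx gsym// !trmx0 trmx1.
move=> v; rewrite -[v]hsubmxK; move: (lsubmx v) (rsubmx v) => v1 v2 v0.
rewrite /prod_metric inner_row_mx !mulmx0 !mul0mx !mxE !addr0.
have i2 : inner 1%:M v2 v2 = dot v2 v2.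
  by rewrite /inner mulmx1 mxE; apply: eq_bigr => i _; rewrite mxE.
have [v10|v10] := eqVneq v1 0.
  have v20 : v2 != 0 by apply: contra_neq v0 => ->; rewrite v10 row_mx0.
  by rewrite v10 /inner !mul0mx mxE add0r -/(inner _ _ _) i2 dot_gt0.
by rewrite ltr_wpDr ?i2 ?dot_ge0//; exact: gpos.
Qed.

(** The Euclidean block is constant, the mixed blocks are zero, and the block of M does not depend
    on the Euclidean coordinates. *)
Lemma partial_prod_metric_r (c : chart A) x a b r (j : 'I_k) :
  chart_image (c : chart (prod_atlas k A)) x ->
  [|| a == rshift n j, b == rshift n j | r == rshift n j] ->
  partial (chart_image (c : chart (prod_atlas k A)))
    (fun y => prod_metric k g c y a b) x r = 0.
Proof.
move=> cx; have st := @chart_image_prod_steps c.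
have cx' : chart_image c (lsubmx x) by move: cx; rewrite chart_image_prod.
rewrite -(splitK a) -(splitK b).
case: (fintype.split a) => i; case: (fintype.split b) => i' /=; last 3 first.
- by rewrite prod_metric_lr partial_cst.
- by rewrite prod_metric_rl partial_cst.
- by rewrite prod_metric_rr partial_cst.
rewrite !eq_lrshift /= => /eqP ->; rewrite prod_metric_ll chart_image_prod.
exact: partial_prod_r (@chart_image_steps c) cx'.
Qed.

End ProductChart.

(** * The elliptic equation of the heights in a chart *)

Section LocalEquation.
Context {R : realType} {M S : topologicalType} {n k m : nat}.
Variables (A : atlas R M n) (B : atlas R S m) (g : metric A) (h : M -> R).
Variables (iota : S -> (M * 'rV[R]_k)%type).
Variables (N : chart (prod_atlas k A) -> S -> 'rV[R]_(n + k)).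
Hypotheses (mfdA : smooth_manifold A) (riemg : riemannian g) (smooth_h : smooth_fun A h).
Hypotheses (hypS : immersed_hypersurface B (prod_atlas k A) iota)
  (normalN : unit_normal B (prod_metric k g) iota N)
  (minS : weighted_minimal B (prod_metric k g) iota N (fun z => h z.1)).
Variables (s : chart B) (c : chart (prod_atlas k A)) (O : set 'rV[R]_m).
Hypotheses (oO : open O) (Odom : O `<=` local_dom iota s c).
Local Notation e i := (basis_vec R i).

Local Notation CI := (chart_image c).
Let F : 'rV[R]_m -> 'rV[R]_(n + k) := local_map iota s c.
Let Nc : 'rV[R]_m -> 'rV[R]_(n + k) := N c \o chart_inv s.
Let Tg x : 'M[R]_(m, n + k) := \matrix_(i, j) 'D_(e i) (fun y => F y 0 j) x.
Let G x := prod_metric k g c (F x).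
Let dG x r a b := partial CI (fun y => prod_metric k g c y a b) (F x) r.
Let H x (i j : 'I_m) p := 'D_(e i) ('D_(e j) (fun y => F y 0 p)) x.
Let dpsi x : 'rV[R]_(n + k) :=
  \row_a partial CI ((fun z => h z.1) \o @chart_inv _ _ _ (prod_atlas k A) c) (F x) a.

Let invS x : O x -> [/\ dom s (chart_inv s x), dom c (iota (chart_inv s x))
  & chart_map s (chart_inv s x) = x].
Proof.
move=> /Odom[q [sq cq] <-]; have [_ [_ _ _ charts _] _ _ _] := hypS.
by have [_ inv _ _ _] := charts s; rewrite inv.
Qed.

Let F_C r j : Cr r O (fun x => F x 0 j).
Proof.
have [_ _ _ sm _] := hypS.
exact: smooth_on_open (sm s c j) oO Odom.
Qed.

Let N_C r j : Cr r O (fun x => Nc x 0 j).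
Proof.
have [_ sm _ _] := normalN.
exact: smooth_on_open (sm s c j) oO Odom.
Qed.

Let F_CI x : O x -> CI (F x).
Proof. by move=> /invS[_ cx _]; exists (iota (chart_inv s x)). Qed.

Let st : stable_steps CI := @chart_image_prod_steps _ _ _ k _ mfdA c.

Let F_derivable x i j : O x -> derivable (fun y => F y 0 j) x (e i).
Proof. by move=> Ox; have [_ /(_ i)[d _]] := F_C 1 j; exact: d. Qed.

Let tangentE x : O x -> tangent iota s c (chart_inv s x) = Tg x.
Proof.
move=> Ox; have [_ _ sx] := invS Ox; apply/matrixP => i j; rewrite !mxE sx.
by apply: (partial_open oO Odom Ox); exact: F_derivable.
Qed.

Let dNE x i j : O x ->
  jac (local_dom iota s c) (N c \o chart_inv s) (chart_map s (chart_inv s x)) i j =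
  'D_(e i) (fun y => Nc y 0 j) x.
Proof.
move=> Ox; have [_ _ sx] := invS Ox; rewrite !mxE sx.
apply: (partial_open oO Odom Ox).
by have [_ /(_ i)[d _]] := N_C 1 j; exact: d.
Qed.

Let posG x : O x -> posdef (G x).
Proof. by move=> Ox; apply: (prod_metric_posdef riemg); exact: F_CI. Qed.

Let Tfree x : O x -> row_free (Tg x).
Proof.
move=> Ox; have [sx cx _] := invS Ox; have [_ _ _ _ free] := hypS.
by rewrite -tangentE//; exact: free.
Qed.

Let TN x : O x -> Tg x *m G x *m (Nc x)^T = 0.
Proof.
move=> Ox; have [sx cx _] := invS Ox; have [_ _ _ orth] := normalN.
apply/matrixP => i j; rewrite ord1 [RHS]mxE -(orth s c _ sx cx i) tangentE//.
by rewrite /inner -!row_mul [RHS]mxE.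
Qed.

Let NN x : O x -> inner (G x) (Nc x) (Nc x) = 1.
Proof.
move=> Ox; have [sx cx _] := invS Ox; have [_ _ unit _] := normalN.
exact: unit c _ cx.
Qed.

Let G_deriv x p b : O x ->
  [/\ forall i, is_derive x (e i) (fun y => G y p b)
        (\sum_a Tg x i a * dG x a p b),
      {for x, continuous (fun y => G y p b)}
    & forall r, {for x, continuous (fun y => dG y r p b)}].
Proof.
move=> Ox.
have [d [cG cdG]] := smooth_comp st oO F_CI (F_C 1) (@prod_metric_smooth _ _ _ k _ _ riemg c p b) Ox.
split=> // i; apply: is_derive_eq (d i) _.
by apply: eq_bigr => r _; rewrite mxE.
Qed.

Let dTN x i j : O x -> \sum_p \sum_b
   (H x i j p * G x p b * Nc x 0 b
    + Tg x j p * (\sum_a Tg x i a * dG x a p b) * Nc x 0 b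
    + Tg x j p * G x p b * 'D_(e i) (fun y => Nc y 0 b) x) = 0.
Proof.
move=> Ox.
pose f p b := (fun y => 'D_(e j) (fun z => F z 0 p) y) \* (fun y => G y p b)
   \* (fun y => Nc y 0 b).
(* The relation [TN] holds on all of the open set [O], so it can be differentiated along each
   coordinate. *)
have f0 : \forall y \near x, (\sum_p \sum_b f p b) y = 0.
  apply: filterS (open_nbhs_nbhs (conj oO Ox)) => y Oy.
  have /matrixP/(_ j 0) := TN Oy; rewrite !mxE => TN0.
  rewrite -[RHS]TN0 exchange_big fct_sumE; apply: eq_bigr => b _.
  rewrite fct_sumE !mxE mulr_suml; apply: eq_bigr => p _.
  by rewrite /f/= ?mxE.
have df p b : is_derive x (e i) (f p b)
   (H x i j p * G x p b * Nc x 0 b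
    + Tg x j p * (\sum_a Tg x i a * dG x a p b) * Nc x 0 b
    + Tg x j p * G x p b * 'D_(e i) (fun y => Nc y 0 b) x).
  have [dGx _ _] := G_deriv p b Ox.
  have dN : derivable (fun y => Nc y 0 b) x (e i).
    by have [_ /(_ i)[d _]] := N_C 1 b; exact: d.
  have dT : derivable ('D_(e j) (fun z => F z 0 p)) x (e i).
    by have [_ /(_ j)[_ [_ /(_ i)[d _]]]] := F_C 2 p; exact: d.
  apply: is_derive_eq (is_deriveM (is_deriveM (derivableP dT) (dGx i)) (derivableP dN)) _.
  transitivity (Tg x j p * G x p b * 'D_(e i) (fun y => Nc y 0 b) x +
    Nc x 0 b * (Tg x j p * (\sum_a Tg x i a * dG x a p b) + G x p b * H x i j p)).
    by rewrite [Tg x j p]mxE.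
  move: ('D_(e i) _ x) (Tg x j p) (G x p b) (\sum_a _) (Nc x 0 b) (H x i j p).
  by move=> r1 r2 r3 r4 r5 r6; ring.
have dsum : is_derive x (e i) (\sum_p \sum_b f p b)
   (\sum_p \sum_b
   (H x i j p * G x p b * Nc x 0 b
    + Tg x j p * (\sum_a Tg x i a * dG x a p b) * Nc x 0 b
    + Tg x j p * G x p b * 'D_(e i) (fun y => Nc y 0 b) x)).
  by apply: is_derive_sum => p; apply: is_derive_sum => b; exact: df.
rewrite -(@derive_val _ _ _ _ _ _ _ dsum).
by rewrite (@near_eq_derive _ _ _ _ (fun _ => 0) _ _ f0) derive_cst.
Qed.

Let amx x := invmx (Tg x *m G x *m (Tg x)^T).
Let low x : 'rV[R]_(n + k) :=
  \row_b (lowered_trace (Tg x) (G x) (dG x) (H x) b - dpsi x 0 b).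
(** The coefficients beta of [lowered_trace_tangent]; this closed formula makes their continuity in
    [x] accessible. *)
Let bvec x := low x *m (Tg x)^T *m amx x.

Let minimal x : O x ->
  - \tr (amx x *m ((\matrix_(i, l) ('D_(e i) (fun y => Nc y 0 l) x +
       \sum_a \sum_b (2^-1 * \sum_r invmx (G x) l r *
          (dG x a b r + dG x b a r - dG x r a b)) * Tg x i a * Nc x 0 b))
        *m G x *m (Tg x)^T))
  - inner (G x) (dpsi x *m invmx (G x)) (Nc x) = 0.
Proof.
move=> Ox; have [sx cx _] := invS Ox.
have := minS sx cx.
rewrite /weighted_mean_curvature /div_hyp /induced_metric (tangentE Ox).
set cov := \matrix_(i, l) _.
have -> : cov_deriv (prod_metric k g) iota N s c (chart_inv s x) = cov; last by [].
by apply/matrixP => i l; rewrite [LHS]mxE [RHS]mxE dNE// tangentE.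
Qed.

(** In a Euclidean direction the lowered Christoffel symbols and the derivative of the weight
    vanish, and the corresponding column of the metric is a basis vector, so only second derivatives
    remain on the left and first derivatives on the right. *)
Let vertical_equation x (l : 'I_k) : O x ->
  \sum_j \sum_i amx x j i * H x i j (rshift n l) =
  \sum_q bvec x 0 q * 'D_(e q) (fun y => F y 0 (rshift n l)) x.
Proof.
move=> Ox; have [md _ _ _ _] := hypS; have cx := F_CI Ox.
have := lowered_trace_tangent md (posG Ox) (Tfree Ox) (TN Ox) (NN Ox)
  (fun i j => dTN i j Ox) (minimal Ox) (rshift n l).
have Gl p : G x p (rshift n l) = (p == rshift n l)%:R.
  rewrite -(splitK p) /G /prod_metric; case: (fintype.split p) => p' /=.
    by rewrite block_mxEur mxE eq_lrshift.
  by rewrite block_mxEdr mxE (inj_eq (@rshift_inj _ _)).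
have lc0 a p : lowered_christoffel (dG x) (rshift n l) a p = 0.
  rewrite /lowered_christoffel.
  have z r p1 q : [|| p1 == rshift n l, q == rshift n l | r == rshift n l] ->
    dG x r p1 q = 0 by exact: partial_prod_metric_r.
  by rewrite !z ?eqxx ?orbT// addr0 subr0 mulr0 subr0.
have dpsi0 : dpsi x 0 (rshift n l) = 0.
  rewrite mxE chart_image_prod; apply: (@partial_prod_r _ _ _ _ (h \o chart_inv (c : chart A))).
    exact: chart_image_steps.
  by move: cx; rewrite chart_image_prod.
rewrite dpsi0 subr0 /lowered_trace => E.
transitivity (\sum_j \sum_i amx x j i *
    (\sum_p H x i j p * G x p (rshift n l) +
     \sum_a \sum_p lowered_christoffel (dG x) (rshift n l) a p * Tg x i a * Tg x j p)).
  apply: eq_bigr => j _; apply: eq_bigr => i _; congr (_ * _).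
  rewrite [X in _ + X]big1 ?addr0 => [|a _]; last first.
    by rewrite big1// => p _; rewrite lc0 !mul0r.
  rewrite (bigD1 (rshift n l))//= Gl eqxx mulr1 big1 ?addr0// => p pl.
  by rewrite Gl (negbTE pl) mulr0.
rewrite E mxE; apply: eq_bigr => q _; congr (_ * _).
rewrite mxE (bigD1 (rshift n l))//= Gl eqxx mulr1 big1 ?addr0 => [|p pl].
  by rewrite mxE.
by rewrite Gl (negbTE pl) mulr0.
Qed.

Let Tg_cont x : O x -> mx_continuous_at Tg x.
Proof.
move=> Ox i j; have [_ /(_ i)[_ [cD _]]] := F_C 1 j.
have -> : (fun y => Tg y i j) = 'D_(e i) (fun y => F y 0 j); last exact: cD.
by apply/funext => y; rewrite mxE.
Qed.

Let H_cont x i j p : O x -> {for x, continuous (fun y => H y i j p)}.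
Proof.
by move=> Ox; have [_ /(_ j)[_ [_ /(_ i)[_ [cD _]]]]] := F_C 2 p; exact: cD.
Qed.

Let amx_cont x : O x -> mx_continuous_at amx x.
Proof.
move=> Ox; apply: invmx_cont; first exact: posdef_unit (posdef_congr (posG Ox) (Tfree Ox)).
apply: mulmx_cont; last exact/trmx_cont/Tg_cont.
apply: mulmx_cont; first exact: Tg_cont.
by move=> p b; have [_] := G_deriv p b Ox.
Qed.

Let low_cont x : O x -> mx_continuous_at low x.
Proof.
move=> Ox i0 b; rewrite {i0}ord1.
have -> : (fun y => low y 0 b) = fun y =>
    lowered_trace (Tg y) (G y) (dG y) (H y) b - dpsi y 0 b.
  by apply/funext => y; rewrite mxE.
have dG_cont r p q : {for x, continuous (fun y => dG y r p q)}.
  by have [_ _] := G_deriv p q Ox; exact.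
apply: cont_sub.
  apply: cont_sum => j _; apply: cont_sum => i _; apply: cont_mul; first exact: amx_cont.
  apply: cont_add.
    apply: cont_sum => p _; apply: cont_mul; first exact: H_cont.
    by have [_] := G_deriv p b Ox.
  apply: cont_sum => a _; apply: cont_sum => p _; apply: cont_mul; last exact: Tg_cont.
  apply: cont_mul; last exact: Tg_cont.
  apply: cont_sub => //; apply: cont_mul; first exact: cont_cst.
  by apply: cont_sub => //; apply: cont_add.
have -> : (fun y => dpsi y 0 b) = fun y =>
    partial CI ((fun z => h z.1) \o @chart_inv _ _ _ (prod_atlas k A) c) (F y) b.
  by apply/funext => y; rewrite mxE.
have sm : smooth_on CI ((fun z => h z.1) \o @chart_inv _ _ _ (prod_atlas k A) c).
  have -> : (fun z => h z.1) \o @chart_inv _ _ _ (prod_atlas k A) c =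
    (h \o chart_inv (c : chart A)) \o lsubmx by [].
  by rewrite chart_image_prod; apply/smooth_on_prod/smooth_h.
by have [_ [_]] := smooth_comp st oO F_CI (F_C 1) sm Ox; exact.
Qed.

Let ell : elliptic_coeffs O amx bvec.
Proof.
move=> x Ox; have [asym apos] := posdef_inv (posdef_congr (posG Ox) (Tfree Ox)).
split=> // [|q]; first exact: amx_cont.
apply: mulmx_cont; last exact: amx_cont.
by apply: mulmx_cont; [exact: low_cont | exact/trmx_cont/Tg_cont].
Qed.

(** The coefficients depend on the immersion itself, but along the given one they are known
    continuous functions of [x]; the equation is therefore linear in the heights and passes to
    combinations of Euclidean coordinates. *)
Lemma strong_max_height (al : 'rV[R]_k) x0 : O x0 ->
  (forall x, O x -> (al *m (rsubmx (F x))^T) 0 0 <= (al *m (rsubmx (F x0))^T) 0 0) ->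
  \forall x \near x0,
    (al *m (rsubmx (F x))^T) 0 0 = (al *m (rsubmx (F x0))^T) 0 0.
Proof.
move=> Ox0.
have uE x : (al *m (rsubmx (F x))^T) 0 0 =
    (\sum_l al 0 l *: (fun y => F y 0 (rshift n l))) x.
  rewrite mxE fct_sumE; apply: eq_bigr => l _.
  by rewrite [_^T _ _]mxE [rsubmx _ _ _]mxE.
set u := \sum_l _ in uE.
pose U1 i := \sum_l al 0 l *: 'D_(e i) (fun y => F y 0 (rshift n l)).
pose U2 i j := \sum_l al 0 l *: 'D_(e j) ('D_(e i) (fun y => F y 0 (rshift n l))).
have c2u : C2_with O u U1 U2.
  move=> x Ox.
  have c2 l := Cr_C2 (F_C 2 (rshift n l)) Ox.
  split=> [i|i|i j|i j].
  - have d l : is_derive x (e i) (fun y => F y 0 (rshift n l))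
        ('D_(e i) (fun y => F y 0 (rshift n l)) x) by have [d _ _ _] := c2 l; exact: d.
    apply: is_derive_eq (is_derive_sum (fun l => is_deriveZ (al 0 l) (d l))) _.
    by rewrite /U1 fct_sumE.
  - have -> : U1 i = fun y => \sum_l al 0 l * 'D_(e i) (fun y => F y 0 (rshift n l)) y.
      by apply/funext => y; rewrite /U1 fct_sumE.
    apply: cont_sum => l _; apply: cont_mul; first exact: cont_cst.
    by have [_ d _ _] := c2 l; exact: d.
  - have d l : is_derive x (e j) ('D_(e i) (fun y => F y 0 (rshift n l)))
        ('D_(e j) ('D_(e i) (fun y => F y 0 (rshift n l))) x).
      by have [_ _ d _] := c2 l; exact: d.
    apply: is_derive_eq (is_derive_sum (fun l => is_deriveZ (al 0 l) (d l))) _.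
    by rewrite /U2 fct_sumE.
  - have -> : U2 i j = fun y => \sum_l al 0 l *
        'D_(e j) ('D_(e i) (fun y => F y 0 (rshift n l))) y.
      by apply/funext => y; rewrite /U2 fct_sumE.
    apply: cont_sum => l _; apply: cont_mul; first exact: cont_cst.
    by have [_ _ _ d] := c2 l; exact: d.
have Lu x : O x -> elliptic_op amx bvec U1 U2 x = 0.
  move=> Ox; apply/eqP; rewrite subr_eq0; apply/eqP.
  (* [H x i j] takes the [j]-derivative first, so [amx x j i * H x i j] is the (j, i) term of
     [elliptic_op]: renaming indices suffices. *)
  transitivity (\sum_l al 0 l * \sum_j \sum_i amx x j i * H x i j (rshift n l)).
    under [RHS]eq_bigr => l _ do rewrite mulr_sumr.
    rewrite [RHS]exchange_big; apply: eq_bigr => j _ /=.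
    under [RHS]eq_bigr => l _ do rewrite mulr_sumr.
    rewrite [RHS]exchange_big; apply: eq_bigr => i _ /=.
    rewrite /U2 fct_sumE mulr_sumr; apply: eq_bigr => l _.
    by rewrite mulrCA.
  under eq_bigr => l _ do rewrite vertical_equation// mulr_sumr.
  rewrite exchange_big; apply: eq_bigr => q _ /=.
  rewrite /U1 fct_sumE mulr_sumr; apply: eq_bigr => l _.
  by rewrite mulrCA.
move=> umax.
have := strong_max_principle oO Ox0 ell c2u Lu.
have umax' x : O x -> u x <= u x0 by move=> /umax; rewrite !uE.
by move=> /(_ umax'); apply: filterS => x; rewrite !uE.
Qed.

End LocalEquation.

(** * From charts to the whole compact hypersurface *)

Lemma within_continuous_at (T U : topologicalType) (A : set T) (f : T -> U) x :
  {within A, continuous f} -> nbhs x A -> {for x, continuous f}.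
Proof.
move=> fA Ax; have /nbhs_subspace_interior nE : A° x by [].
by rewrite /prop_for /continuous_at nE; exact: fA.
Qed.

Section MaximumPrinciple.
Context {R : realType} {M S : topologicalType} {n k m : nat}.
Variables (A : atlas R M n) (B : atlas R S m) (g : metric A) (h : M -> R).
Variables (iota : S -> (M * 'rV[R]_k)%type).
Variables (N : chart (prod_atlas k A) -> S -> 'rV[R]_(n + k)).
Hypotheses (mfdA : smooth_manifold A) (riemg : riemannian g) (smooth_h : smooth_fun A h).
Hypotheses (hypS : immersed_hypersurface B (prod_atlas k A) iota)
  (normalN : unit_normal B (prod_metric k g) iota N)
  (minS : weighted_minimal B (prod_metric k g) iota N (fun z => h z.1)).

Definition height (al : 'rV[R]_k) (q : S) : R := (al *m (iota q).2^T) 0 0.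

Let mfdB : smooth_manifold B. Proof. by case: hypS. Qed.

Lemma height_cont al : continuous (height al).
Proof.
have [_ _ ciota _ _] := hypS => q.
have -> : height al = fun q => \sum_l al 0 l * (iota q).2 0 l.
  by apply/funext => p; rewrite /height mxE; apply: eq_bigr => l _; rewrite mxE.
apply: cont_sum => l _; apply: cont_mul; first exact: cont_cst.
have c2 : {for q, continuous (fun q => (iota q).2)}.
  exact: (@continuous_comp _ _ _ iota snd q (ciota q) (cvg_snd)).
exact: (cvg_comp _ (fun v : 'rV[R]_k => v 0 l) c2 (@coord_cvg R k _ l)).
Qed.

(** In a chart modelled on the half-space, a point off the boundary has positive zeroth coordinate,
    and this persists nearby. *)
Lemma interior_chart (s : chart B) q : dom s q -> ~ boundary B q ->
  nbhs (chart_map s q) (chart_image s).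
Proof.
move=> sq nbq; have [_ _ _ /(_ s)[_ _ [Q oQ imE] _ _] _] := mfdB.
have : chart_image s (chart_map s q) by exists q.
rewrite imE => -[Qx mx]; apply: filterI; first exact: open_nbhs_nbhs.
move: mx; rewrite /model; case: ifPn => [bs|_ _]; last exact: filterT.
move=> [i [i0 xi]].
have xi0 : 0 < chart_map s q 0 i.
  rewrite lt_def xi andbT; apply/eqP => xi0; apply: nbq.
  by exists s; split=> //; exists i.
have : \forall x \near chart_map s q, 0 < (x : 'rV[R]_m) 0 i.
  have cx : (fun x : 'rV[R]_m => x 0 i) @ chart_map s q --> chart_map s q 0 i.
    exact: coord_cvg.
  by move: cx => /(cvgr_gt _)/(_ 0 xi0).
by apply: filterS => x x0; exists i; split=> //; exact: ltW.
Qed.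

Lemma local_dom_nbhs (s : chart B) (c : chart (prod_atlas k A)) q :
  dom s q -> dom c (iota q) -> ~ boundary B q ->
  nbhs (chart_map s q) (local_dom iota s c).
Proof.
move=> sq cq nbq; have xim := interior_chart sq nbq.
have [_ _ _ /(_ s)[odoms invs _ _ cinv] _] := mfdB.
have [_ _ _ /(_ (c : chart A))[odomc _ _ _ _] _] := mfdA.
have [_ _ ciota _ _] := hypS.
have cinvx := within_continuous_at cinv xim.
have : nbhs q (dom s `&` iota @^-1` dom c).
  apply: filterI; first exact: open_nbhs_nbhs.
  apply: ciota; have : nbhs (iota q).1 (dom (c : chart A)).
    by apply: open_nbhs_nbhs; split=> //; have [] := cq.
  by move=> cnbhs; exists (dom (c : chart A), setT) => //=; split=> //; exact: filterT.
rewrite -[in nbhs q](invs q sq) => /cinvx U.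
near=> x.
have [p sp px] : chart_image s x by near: x.
have [_ Up] : (dom s `&` iota @^-1` dom c) (chart_inv s x) by near: x; exact: U.
exists p => //; split=> //=.
by move: Up; rewrite -px /= invs.
Unshelve. all: by end_near. Qed.

(** [strong_max_height] is applied on the interior of [local_dom], and the conclusion is pulled back
    by continuity of the chart. *)
Lemma height_locally_cst al q : ~ boundary B q ->
  (forall p, height al p <= height al q) ->
  \forall p \near q, height al p = height al q.
Proof.
move=> nbq umax.
have [_ _ /(_ q)[s sq] chartsB _] := mfdB.
have [_ _ /(_ (iota q).1)[c cq] _ _] := mfdA.
have cq' : dom (c : chart (prod_atlas k A)) (iota q) by split.
have xdom := local_dom_nbhs sq cq' nbq.
have [odoms invs _ cmap _] := chartsB s.
have heightE x : (al *m (rsubmx (local_map iota s (c : chart (prod_atlas k A)) x))^T) 0 0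
    = height al (chart_inv s x) by rewrite /local_map /= row_mxKr.
have prem x : (local_dom iota s (c : chart (prod_atlas k A)))° x ->
    (al *m (rsubmx (local_map iota s (c : chart (prod_atlas k A)) x))^T) 0 0 <=
    (al *m (rsubmx (local_map iota s (c : chart (prod_atlas k A)) (chart_map s q)))^T) 0 0.
  by move=> _; rewrite !heightE (invs q sq).
have : \forall x \near chart_map s q, height al (chart_inv s x) = height al q.
  have := strong_max_height mfdA riemg smooth_h hypS normalN minS
    (@open_interior _ _) (@interior_subset _ _) xdom prem.
  by apply: filterS => x; rewrite !heightE (invs q sq).
have cmapq := within_continuous_at cmap (open_nbhs_nbhs (conj odoms sq)).
move=> /cmapq Hq; near=> p.
have sp : dom s p by near: p; exact: open_nbhs_nbhs.
by rewrite -[p in LHS](invs p sp); near: p; exact: Hq.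
Unshelve. all: by end_near. Qed.

Hypotheses (compS : compact [set: S]) (connS : connected [set: S])
  (bdS : boundary B !=set0).

(** If the maximum were not attained on the boundary, its level set would be open by
    [height_locally_cst], as well as closed and nonempty, hence all of [S]; but the boundary is
    nonempty. *)
Lemma height_max_boundary al q :
  exists2 b, boundary B b & height al q <= height al b.
Proof.
have [q0 _ qmax] : exists2 c, c \in [set: S] &
    forall t, t \in [set: S] -> height al t <= height al c.
  apply: compact_EVT_max => //; first by exists q.
  by apply: continuous_subspaceT; exact: height_cont.
have {}qmax p : height al p <= height al q0 by apply: qmax; rewrite inE.
have [[b bb bq]|nb] := pselect (exists2 b, boundary B b & height al b = height al q0).
  by exists b => //; rewrite bq.
pose C := [set p | height al p = height al q0].
have CT : C = [set: S].
  apply: connS; first by exists q0.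
    exists C; last by rewrite setTI.
    rewrite openE => p Cp; rewrite /interior.
    have pb : ~ boundary B p by move=> pb; apply: nb; exists p.
    have pmax t : height al t <= height al p by rewrite (Cp : height al p = _).
    by apply: filterS (height_locally_cst pb pmax) => t tp; rewrite /C/= tp.
  exists C; last by rewrite setTI.
  have -> : C = height al @^-1` [set height al q0] by [].
  apply: preimage_closed; first by move=> p _; exact: height_cont.
  exact: closed_eq.
have [b bb] := bdS; case: nb; exists b => //.
by have : C b by rewrite CT.
Qed.

Lemma range_sub_half_space al (d : R) :
  (forall b, boundary B b -> height al b <= d) -> forall q, height al q <= d.
Proof.
by move=> bd q; have [b /bd bb qb] := height_max_boundary al q; exact: le_trans qb bb.
Qed.

End MaximumPrinciple.

Theorem corollary3p14 (R : realType) (n k : nat) (k_gt0 : (0 < k)%N)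
    (* the manifold M, its orientation, its metric and the weight *)
    (M : topologicalType) (A : atlas R M n) (mfdM : smooth_manifold A)
    (connM : connected [set: M])
    (o : chart A -> M -> bool) (orientM : orientation o)
    (g : metric A) (riemM : riemannian g)
    (h : M -> R) (smooth_h : smooth_fun A h)
    (* the hypersurface iota : S -> M x R^k, with unit normal N *)
    (m : nat) (S : topologicalType) (B : atlas R S m)
    (iota : S -> (M * 'rV[R]_k)%type)
    (hypS : immersed_hypersurface B (prod_atlas k A) iota)
    (compS : compact [set: S]) (connS : connected [set: S])
    (N : chart (prod_atlas k A) -> S -> 'rV[R]_(n + k))
    (normalN : unit_normal B (prod_metric k g) iota N)
    (minS : weighted_minimal B (prod_metric k g) iota N (fun z => h z.1))
    (bdS : boundary B !=set0) :
  range iota `<=` horizontal_hull (iota @` boundary B) /\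
  (forall P : set 'rV[R]_k, affine_hyperplane P ->
     iota @` boundary B `<=` setT `*` P -> range iota `<=` setT `*` P).
Proof.
have half := range_sub_half_space mfdM riemM smooth_h hypS normalN minS compS connS bdS.
split=> [z [q _ <-]|P [a [d [a0 ->]]] bdP z [q _ <-]].
  move=> H [[F [a [d [a0 ->]]] ->] bdH]; split=> //=.
  by apply: half => b bb; have [] := bdH _ (imageP iota bb).
have bd b : boundary B b -> height iota a b = d.
  by move=> bb; have [] := bdP _ (imageP iota bb).
split=> //=; apply/eqP; rewrite eq_le; apply/andP; split.
  by apply: half => b /bd ->.
(* The opposite half-space bounded by the same hyperplane gives the reverse inequality. *)
have := half (- a) (- d) _ q; rewrite /height mulNmx mxE lerN2; apply=> b /bd <-.
by rewrite mulNmx mxE.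
Qed.
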